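(* Let $\mathcal{H}$ be a separable Hilbert space and let $\mathcal{W},\mathcal{V}$ be closed subspaces of $\mathcal{H}$ with $\mathcal{H}=\mathcal{W}\oplus\mathcal{V}^{\perp}$. Let $\epsilon\ge0$, let $\mathcal{F}=\{f_k\}_{k=1}^{\infty}$ be a frame for $\mathcal{W}$ with bounds $\alpha$ and $\beta$, and let $\widetilde{\mathcal{G}}=\{\widetilde{g}_k\}_{k=1}^{\infty}\subset\mathcal{W}$ be such that $\sum_{k=1}^{\infty}|\langle f,f_k-\widetilde{g}_k\rangle|^2\le r\|f\|^2$ for $f\in\mathcal{W}$, with $0\le r\le\frac{\alpha\epsilon^{2}}{(\|\pi_{\mathcal{V}\mathcal{W}^{\perp}}\|+\epsilon)^2}$. Then: (i) $\widetilde{\mathcal{G}}$ is a frame for $\mathcal{W}$ with bounds $(\sqrt{\alpha}-\sqrt{r})^2$ and $(\sqrt{r}+\sqrt{\beta})^2$. (ii) If $\mathcal{G}=\{g_k\}_{k=1}^{\infty}\subset\mathcal{V}$ is given by $g_k=\pi_{\mathcal{V}\mathcal{W}^{\perp}}\big(T_{\widetilde{\mathcal{G}}}T_{\widetilde{\mathcal{G}}}^{*}\big)^{\dagger}\widetilde{g}_k$, then $\mathcal{G}$ is an $\epsilon$-approximate oblique dual frame of $\mathcal{F}$ in $\mathcal{V}$.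
   Context: The direct sum $\mathcal{H}=\mathcal{W}\oplus\mathcal{V}^{\perp}$ (equivalently $\mathcal{H}=\mathcal{V}\oplus\mathcal{W}^{\perp}$) is not assumed orthogonal. $\pi_{\mathcal{W}\mathcal{V}^{\perp}}$ denotes the oblique projection onto $\mathcal{W}$ along $\mathcal{V}^{\perp}$ (identity on $\mathcal{W}$, zero on $\mathcal{V}^{\perp}$); similarly $\pi_{\mathcal{V}\mathcal{W}^{\perp}}$ is the projection onto $\mathcal{V}$ along $\mathcal{W}^{\perp}$. $T^{\dagger}$ denotes the Moore–Penrose pseudo-inverse of a closed-range bounded operator $T$. A sequence $\{f_k\}_{k=1}^{\infty}\subset\mathcal{W}$ is a frame for $\mathcal{W}$ with (lower and upper) bounds $\alpha,\beta$ if $0<\alpha\le\beta<\infty$ and $\alpha\|f\|^2\le\sum_{k}|\langle f,f_k\rangle|^2\le\beta\|f\|^2$ for all $f\in\mathcal{W}$. For such $\mathcal{F}=\{f_k\}$, $T_{\mathcal{F}}:\ell^2\to\mathcal{H}$, $T_{\mathcal{F}}\{c_k\}=\sum_k c_kf_k$ is the synthesis operator, with adjoint $T_{\mathcal{F}}^{*}f=\{\langle f,f_k\rangle\}_k$. Frames $\mathcal{F}$ for $\mathcal{W}$ and $\mathcal{G}$ for $\mathcal{V}$ are $\epsilon$-approximate oblique dual frames (and $\mathcal{G}$ is an $\epsilon$-approximate oblique dual frame of $\mathcal{F}$ in $\mathcal{V}$) if $\|\pi_{\mathcal{W}\mathcal{V}^{\perp}}-T_{\mathcal{F}}T_{\mathcal{G}}^{*}\|\le\epsilon$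 or, equivalently, $\|\pi_{\mathcal{V}\mathcal{W}^{\perp}}-T_{\mathcal{G}}T_{\mathcal{F}}^{*}\|\le\epsilon$.
   Formalization: In part (i), when W = {0}, it is additionally assumed that r < α: in that case the stated bound allows r = α, and then the lower frame bound (√α − √r)² would be 0, which is not a positive frame bound. *)

(* Defs.v *)
From HB Require Import structures.
From mathcomp Require Import all_boot all_order all_algebra.
From mathcomp Require Import all_classical all_reals all_analysis.
From mathcomp Require Import sesquilinear complex.

Set Implicit Arguments.
Unset Strict Implicit.
Unset Printing Implicit Defensive.

Import Order.TTheory GRing.Theory Num.Theory.
Import numFieldNormedType.Exports.

Local Open Scope classical_set_scope.
Local Open Scope ring_scope.

(* The scalar field of the Hilbert space is either R or C = R[i]. *)
Variant scalar_kind := RealScalars | ComplexScalars.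

Definition scalars (R : realType) (k : scalar_kind) : numFieldType :=
  match k with RealScalars => R | ComplexScalars => R[i] end.

Definition re (R : realType) (k : scalar_kind) : scalars R k -> R :=
  match k with RealScalars => id | ComplexScalars => @complex.Re R end.

Definition conj (R : realType) (k : scalar_kind) :
    scalars R k -> scalars R k :=
  match k with RealScalars => id | ComplexScalars => @conjc R end.

Section Hilbert.
Context {R : realType} {k : scalar_kind}.
Local Notation K := (scalars R k).
Context {H : completeNormedModType K}.

Definition separable := exists2 D : set H, countable D & dense D.

(* In MathComp-Analysis the norm of a K-module takes its values in K (in the
   nonnegative real elements of K); rnorm and rabs are the same numbers in R. *)
Definition rnorm (x : H) : R := re `|x|.
Definition rabs (a : K) : R := re `|a|.

(* Extended-real valued, so that an unbounded map has norm +oo. *)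
Definition opnorm (T : H -> H) : \bar R :=
  ereal_sup [set (rnorm (T x))%:E | x in [set x | rnorm x <= 1]].

Definition closed_subspace (A : set H) : Prop :=
  GRing.submod_closed [in A] /\ closed A.

Definition direct_sum (A B : set H) : Prop :=
  A `&` B = [set 0] /\
  forall x, exists a b, [/\ A a, B b & x = a + b].

(* The component in A of x, with respect to H = A (+) B: it is determined by
   its defining property when direct_sum A B holds. *)
Definition oblique_proj (A B : set H) (x : H) : H :=
  xget 0 [set a | A a /\ B (x - a)].

(* ip is linear in its first argument. *)
Variable ip : {dot H for @conj R k}.

Definition orthc (A : set H) : set H :=
  [set x | forall a, A a -> ip x a = 0].

Definition self_adjoint (T : H -> H) : Prop :=
  forall x y, ip (T x) y = ip x (T y).

(* The Penrose equations. *)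
Definition is_moore_penrose (T S : H -> H) : Prop :=
  [/\ linear S, continuous S,
      T \o S \o T = T, S \o T \o S = S &
      self_adjoint (T \o S) /\ self_adjoint (S \o T)].

(* At most one S satisfies is_moore_penrose T S, and there is one when T is linear,
   bounded and has a closed range. *)
Definition moore_penrose (T : H -> H) : H -> H := xget (fun=> 0) (is_moore_penrose T).

(* sum_k |<x, f_k>|^2, a series of nonnegative terms with value in [0, +oo] *)
Definition frame_sum (f : nat -> H) (x : H) : \bar R :=
  (\sum_(0 <= n <oo) (rabs (ip x (f n)) ^+ 2)%:E)%E.

Definition frame_bounds (A : set H) (f : nat -> H) (a b : R) : Prop :=
  [/\ forall n, A (f n), 0 < a, a <= b &
      forall x, A x ->
        ((a * rnorm x ^+ 2)%:E <= frame_sum f x)%E /\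
        (frame_sum f x <= (b * rnorm x ^+ 2)%:E)%E].

Definition frame (A : set H) (f : nat -> H) : Prop :=
  exists a b, frame_bounds A f a b.

(* T_f; the series converges for square-summable c when f is a frame (or
   merely satisfies the upper frame inequality), and only this case is used. *)
Definition synthesis (f : nat -> H) (c : nat -> K) : H :=
  lim (series (fun n => c n *: f n) @ \oo).

(* T_f^* *)
Definition analysis (f : nat -> H) (x : H) : nat -> K :=
  fun n => ip x (f n).

Definition approx_oblique_dual (W V : set H) (eps : R) (f g : nat -> H) :
    Prop :=
  [/\ frame W f, frame V g &
      (opnorm (oblique_proj W (orthc V) \- (synthesis f \o analysis g))%R
        <= eps%:E)%E].

End Hilbert.

Arguments separable {R k} H.

(* Main.v *)
Require Import Defs.
From HB Require Import structures.
From mathcomp Require Import all_boot all_order all_algebra.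
From mathcomp Require Import all_classical all_reals all_analysis.
From mathcomp Require Import sesquilinear complex ring lra.

(* The oblique projection pi onto W along V^perp is bounded because |v| <= C |P v|
   on V, P being the orthogonal projection onto W (uniform boundedness); the
   same bound makes P coercive on V, which yields H = V (+) W^perp, and the
   projection pi' onto V along W^perp is the adjoint of pi.  Let S be the frame
   operator of ft and y = S^dagger (pi x).  Then S y = pi x, and moving pi' and S
   to the other side gives <x, g_n> = <y, ft_n>, so the reconstruction error is
   sum_n <y, ft_n> (ft_n - f_n).  Its squared norm is at most r <S y, y>, where
   <S y, y> <= |pi x|^2 / (sqrt alpha - sqrt r)^2 and |pi x| <= ||pi'|| |x|; the
   bound on r is exactly what turns this into eps^2. *)

Set Implicit Arguments.
Unset Strict Implicit.
Unset Printing Implicit Defensive.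

Import Order.TTheory GRing.Theory Num.Theory.
Import numFieldNormedType.Exports.

Local Open Scope classical_set_scope.
Local Open Scope ring_scope.

(** [oblique_proj] is chosen pointwise, so nothing makes it bounded a priori; were its norm +oo,
    [fine] would turn it into 0 and the bound on r would lose its meaning. This is why boundedness
    must be proved at all. One variational lemma, [symmetric_coercive_solution], supplies every
    inverse: T = id gives orthogonal projections, T = P on V gives H = V (+) W^perp, and the frame
    operator on W gives its pseudo-inverse. With nu = ||pi'||, the error estimate needs sqrt r nu <=
    eps (sqrt alpha - sqrt r), that is sqrt r (nu + eps) <= eps sqrt alpha: the square root of the
    assumed bound. It forces r < alpha as soon as nu > 0. If W = 0 then nu = 0 and r = alpha is
    possible, a case treated apart. *)

(** * Real and complex scalars handled uniformly *)

Section Scalars.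
Context {R : realType} {k : scalar_kind}.
Local Notation K := (scalars R k).

(** Norms and moduli are nonnegative elements of [K], hence of the form [of_real t]; this lets each
    estimate be transported to R for both kinds of scalars at once. *)
Definition of_real : R -> K :=
  match k return R -> scalars R k with
  | RealScalars => id
  | ComplexScalars => fun t => (t%:C)%C
  end.

Lemma of_realD s t : of_real (s + t) = of_real s + of_real t.
Proof. by rewrite /of_real; case: k => //=; rewrite rmorphD. Qed.

Lemma of_realM s t : of_real (s * t) = of_real s * of_real t.
Proof. by rewrite /of_real; case: k => //=; rewrite rmorphM. Qed.

Lemma of_real0 : of_real 0 = 0.
Proof. by rewrite /of_real; case: k. Qed.

Lemma of_real1 : of_real 1 = 1.
Proof. by rewrite /of_real; case: k. Qed.

Lemma of_real_le s t : (of_real s <= of_real t) = (s <= t).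
Proof. by rewrite /of_real; case: k => //=; rewrite lecR. Qed.

Lemma of_real_lt s t : (of_real s < of_real t) = (s < t).
Proof. by rewrite /of_real; case: k => //=; rewrite ltcR. Qed.

Lemma of_realK t : re (of_real t) = t.
Proof. by rewrite /of_real /re; case: k. Qed.

Lemma re_real (a : K) : 0 <= a -> of_real (re a) = a.
Proof.
rewrite /of_real /re; case: k a => //= a a_ge0.
by rewrite RRe_real // ger0_real.
Qed.

Lemma reD (a b : K) : re (a + b) = re a + re b.
Proof. by rewrite /re; case: k a b => //= -[? ?] [? ?]. Qed.

Lemma reN (a : K) : re (- a) = - re a.
Proof. by rewrite /re; case: k a => //= -[]. Qed.

Lemma reB (a b : K) : re (a - b) = re a - re b.
Proof. by rewrite reD reN. Qed.

Lemma re0 : re (0 : K) = 0.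
Proof. by rewrite -of_real0 of_realK. Qed.

Lemma re_sum (I : Type) (s : seq I) (F : I -> K) :
  re (\sum_(i <- s) F i) = \sum_(i <- s) re (F i).
Proof. exact: (big_morph _ reD re0). Qed.

Lemma reZ t (a : K) : re (of_real t * a) = t * re a.
Proof.
rewrite /of_real /re; case: k a => //= -[x y] /=.
by rewrite mul0r subr0.
Qed.

Lemma conj_of_real t : conj (of_real t) = of_real t.
Proof. by rewrite /conj /of_real; case: k => //=; rewrite oppr0. Qed.

Lemma conjK (a : K) : conj (conj a) = a.
Proof. by rewrite /conj; case: k a => //= a; rewrite conjcK. Qed.

Lemma conjM (a b : K) : conj (a * b) = conj a * conj b.
Proof. by rewrite /conj; case: k a b => //= a b; rewrite rmorphM. Qed.

Lemma re_conj (a : K) : re (conj a) = re a.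
Proof. by rewrite /re /conj; case: k a => //= -[]. Qed.

Lemma of_real_rabs (a : K) : of_real (rabs a) = `|a|.
Proof. by rewrite re_real. Qed.

Lemma rabs_ge0 (a : K) : 0 <= rabs a.
Proof. by rewrite -of_real_le of_real0 of_real_rabs. Qed.

Lemma of_real_inj : injective of_real.
Proof. by move=> s t /(congr1 (@re R k)); rewrite !of_realK. Qed.

Lemma rabsM (a b : K) : rabs (a * b) = rabs a * rabs b.
Proof. by apply: of_real_inj; rewrite of_realM !of_real_rabs normrM. Qed.

Lemma rabsN (a : K) : rabs (- a) = rabs a.
Proof. by rewrite /rabs normrN. Qed.

Lemma rabsD (a b : K) : rabs (a + b) <= rabs a + rabs b.
Proof. by rewrite -of_real_le of_realD !of_real_rabs ler_normD. Qed.

Lemma rabs_eq0 (a : K) : rabs a = 0 -> a = 0.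
Proof.
by move=> a0; apply/normr0_eq0; rewrite -of_real_rabs a0 of_real0.
Qed.

Lemma mulr_conj (a : K) : a * conj a = of_real (rabs a ^+ 2).
Proof.
rewrite expr2 of_realM of_real_rabs -expr2 /conj.
by case: k a => /= a; [rewrite real_normK ?num_real | rewrite sqr_normc].
Qed.

Lemma rabs_of_real t : rabs (of_real t) = `|t|.
Proof.
apply/eqP; rewrite -(@eqrXn2 _ 2) ?rabs_ge0 //; apply/eqP/of_real_inj.
by rewrite -mulr_conj conj_of_real -of_realM real_normK ?num_real // expr2.
Qed.

Lemma rabs_conj (a : K) : rabs (conj a) = rabs a.
Proof.
apply/eqP; rewrite -(@eqrXn2 _ 2) ?rabs_ge0 //; apply/eqP/of_real_inj.
by rewrite -!mulr_conj conjK mulrC.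
Qed.

Lemma re_le_rabs (a : K) : re a <= rabs a.
Proof.
rewrite -of_real_le of_real_rabs /re /of_real.
case: k a => /= a; first exact: ler_norm.
by apply: le_trans (normc_ge_Re _); rewrite lecR ler_norm.
Qed.

(* Young's inequality, division-free: the weights of the usual form
   (1 + s/t)|a|^2 + (1 + t/s)|b|^2 are multiplied by s t. *)
Lemma rabsD_sqr_le (s t : R) (a b : K) : 0 <= s -> 0 <= t ->
  s * t * rabs (a + b) ^+ 2 <=
  (s + t) * (s * rabs a ^+ 2 + t * rabs b ^+ 2).
Proof.
move=> s0 t0.
have := rabsD a b; have := rabs_ge0 (a + b).
move: (rabs _) (rabs a) (rabs b) => c x y c0 cxy.
have st0 : 0 <= s * t by rewrite mulr_ge0.
have c2 : c ^+ 2 <= (x + y) ^+ 2 by rewrite lerXn2r // nnegrE (le_trans c0).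
apply: (le_trans (ler_wpM2l st0 c2)).
(* The two sides differ by exactly (s x - t y)^2, so the bound is sharp when s x = t y. *)
have := sqr_ge0 (s * x - t * y); nra.
Qed.

End Scalars.

(** * The norm with values in R: convergence, completeness, continuity *)

Section Norm.
Context {R : realType} {k : scalar_kind}.
Local Notation K := (scalars R k).
Context {H : completeNormedModType K}.
Implicit Types (x y : H) (u : nat -> H).

Lemma of_real_rnorm x : of_real (rnorm x) = `|x| :> K.
Proof. by rewrite re_real. Qed.

Lemma rnorm_ge0 x : 0 <= rnorm x.
Proof. by rewrite -(@of_real_le _ k) of_real0 of_real_rnorm. Qed.

Lemma rnormD x y : rnorm (x + y) <= rnorm x + rnorm y.
Proof. by rewrite -(@of_real_le _ k) of_realD !of_real_rnorm ler_normD. Qed.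

Lemma rnormN x : rnorm (- x) = rnorm x.
Proof. by rewrite /rnorm normrN. Qed.

Lemma rnormC x y : rnorm (x - y) = rnorm (y - x).
Proof. by rewrite -rnormN opprB. Qed.

Lemma rnorm0 : rnorm (0 : H) = 0.
Proof. by rewrite /rnorm normr0 re0. Qed.

Lemma rnorm_eq0 x : rnorm x = 0 -> x = 0.
Proof. by move=> x0; apply/normr0_eq0; rewrite -of_real_rnorm x0 of_real0. Qed.

Lemma rnormZ (a : K) x : rnorm (a *: x) = rabs a * rnorm x.
Proof.
apply: (@of_real_inj _ k).
by rewrite of_realM of_real_rnorm of_real_rabs of_real_rnorm normrZ.
Qed.

Lemma cvg_rnormP u x :
  u @ \oo --> x <-> (fun n => rnorm (u n - x)) @ \oo --> (0 : R).
Proof.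
split=> [/cvgrPdist_lt ux|/cvgrPdist_lt ux]; apply/cvgrPdist_lt => e e0.
  have e0' : 0 < of_real e :> K by rewrite -of_real0 of_real_lt.
  near=> n; rewrite sub0r normrN ger0_norm ?rnorm_ge0 //.
  rewrite -(@of_real_lt _ k) of_real_rnorm distrC; near: n; exact: ux.
have ee : of_real (re e) = e by rewrite re_real // ltW.
have e0' : 0 < re e by rewrite -(@of_real_lt _ k) of_real0 ee.
near=> n; rewrite -ee -of_real_rnorm of_real_lt rnormC.
have : `|0 - rnorm (u n - x)| < re e by near: n; exact: ux.
by rewrite sub0r normrN ger0_norm ?rnorm_ge0.
Unshelve. all: by end_near. Qed.

Lemma rnorm_cauchy_cvg u :
  (forall e : R, 0 < e -> exists N, forall m n,
     (N <= m)%N -> (N <= n)%N -> rnorm (u m - u n) <= e) ->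
  exists x, u @ \oo --> x.
Proof.
move=> cu; suff : cvg (u @ \oo) by move=> /cvg_ex.
suff : cauchy (u @ \oo) by exact: cauchy_cvg.
suff : cauchy_ex (u @ \oo) by exact: cauchy_exP.
move=> e e0.
have ee : of_real (re e) = e by rewrite re_real // ltW.
have e0' : 0 < re e by rewrite -(@of_real_lt _ k) of_real0 ee.
(* Halved because the hypothesis bounds non-strictly while balls are strict. *)
have [|N uN] := cu (re e / 2); first by rewrite divr_gt0.
exists (u N), N => // n /= Nn.
rewrite -ball_normE /ball_ /= -of_real_rnorm -ee of_real_lt.
by rewrite (le_lt_trans (uN _ _ _ Nn)) // ltr_pdivrMr // ltr_pMr // ltr1n.
Qed.

Lemma lipschitz_continuous (C : R) (T : H -> H) :
  (forall x y, rnorm (T x - T y) <= C * rnorm (x - y)) -> continuous T.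
Proof.
move=> TC x; apply/cvgrPdist_lt => e e0.
have ee : of_real (re e) = e by rewrite re_real // ltW.
have e0' : 0 < re e by rewrite -(@of_real_lt _ k) of_real0 ee.
(* The sign of [C] is unknown; [|C| + 1] is a positive upper bound of it. *)
have d0 : 0 < re e / (`|C| + 1) by rewrite divr_gt0 // ltr_wpDl.
have d0' : 0 < of_real (re e / (`|C| + 1)) :> K.
  by rewrite -of_real0 of_real_lt.
near=> y.
have : `|x - y| < of_real (re e / (`|C| + 1)).
  by near: y; exact: cvgr_dist_lt.
rewrite -of_real_rnorm of_real_lt ltr_pdivlMr ?ltr_wpDl // => xy.
rewrite -of_real_rnorm -ee of_real_lt (le_lt_trans (TC _ _)) //.
apply: le_lt_trans xy; rewrite mulrC ler_wpM2l ?rnorm_ge0 //.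
by rewrite (le_trans (ler_norm C)) // lerDl.
Unshelve. all: by end_near. Qed.

Lemma closed_lim (A : set H) u x :
  closed A -> (forall n, A (u n)) -> u @ \oo --> x -> A x.
Proof.
move=> clA Au ux; apply: (@closed_cvg _ _ \oo eventually_filter u) ux => //.
exact: nearW.
Qed.

End Norm.

(** * Closed subspaces *)

Section Subspace.
Context {R : realType} {k : scalar_kind}.
Local Notation K := (scalars R k).
Context {H : completeNormedModType K}.
Implicit Types (x y : H).
Variable A : set H.
Hypothesis A_sub : closed_subspace A.

Lemma subspace0 : A 0.
Proof. by case: A_sub => -[/set_mem]. Qed.

Lemma subspaceP (a : K) x y : A x -> A y -> A (a *: x + y).
Proof.
by move=> Ax Ay; case: A_sub => -[_ h] _; apply/set_mem/h; apply/mem_set.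
Qed.

Lemma subspaceD x y : A x -> A y -> A (x + y).
Proof. by move=> Ax Ay; rewrite -(scale1r x); exact: subspaceP. Qed.

Lemma subspaceZ (a : K) x : A x -> A (a *: x).
Proof. by move=> Ax; rewrite -(addr0 (a *: x)); exact/subspaceP/subspace0. Qed.

Lemma subspaceB x y : A x -> A y -> A (x - y).
Proof.
by move=> Ax Ay; rewrite addrC -scaleN1r; exact: subspaceP.
Qed.

Lemma subspace_sum (I : Type) (s : seq I) (F : I -> H) :
  (forall i, A (F i)) -> A (\sum_(i <- s) F i).
Proof.
by move=> AF; elim/big_ind: _ => //; [exact: subspace0 | exact: subspaceD].
Qed.

End Subspace.

(** * The inner product, its real part, and orthogonal complements *)

Section InnerProduct.
Context {R : realType} {k : scalar_kind}.
Local Notation K := (scalars R k).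
Context {H : completeNormedModType K}.
Variable ip : {dot H for @conj R k}.
Hypothesis ip_norm : forall x : H, ip x x = `|x| ^+ 2.
Implicit Types (x y z : H) (A : set H).

(* H viewed as a real Hilbert space *)
Definition real_ip x y : R := re (ip x y).
Local Notation rip := real_ip.

Lemma ipC x y : ip x y = conj (ip y x).
Proof.
by rewrite (@hermitian_subproof _ _ false _ ip) expr0 mul1r.
Qed.

Lemma ipZr (a : K) x y : ip x (a *: y) = conj a * ip x y.
Proof. by rewrite linearZr_LR. Qed.

Lemma ipZl (a : K) x y : ip (a *: x) y = a * ip x y.
Proof. by rewrite linearZl_LR. Qed.

Lemma ipDl x y z : ip (x + y) z = ip x z + ip y z.
Proof. exact: linearDl. Qed.

Lemma ipBl x y z : ip (x - y) z = ip x z - ip y z.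
Proof. exact: linearBl. Qed.

Lemma ipBr x y z : ip x (y - z) = ip x y - ip x z.
Proof. exact: linearBr. Qed.

Lemma ipDr x y z : ip x (y + z) = ip x y + ip x z.
Proof. exact: linearDr. Qed.

Lemma ipNr x y : ip x (- y) = - ip x y.
Proof. exact: linearNr. Qed.

Lemma ip_suml (I : Type) (s : seq I) (F : I -> H) y :
  ip (\sum_(i <- s) F i) y = \sum_(i <- s) ip (F i) y.
Proof. exact: linear_sumlz. Qed.

Lemma ripC x y : rip x y = rip y x.
Proof. by rewrite /real_ip ipC re_conj. Qed.

Lemma ripDl x y z : rip (x + y) z = rip x z + rip y z.
Proof. by rewrite /real_ip linearDl reD. Qed.

Lemma ripDr x y z : rip x (y + z) = rip x y + rip x z.
Proof. by rewrite /real_ip linearDr reD. Qed.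

Lemma ripNl x y : rip (- x) y = - rip x y.
Proof. by rewrite /real_ip linearNl reN. Qed.

Lemma ripNr x y : rip x (- y) = - rip x y.
Proof. by rewrite /real_ip linearNr reN. Qed.

Lemma ripBl x y z : rip (x - y) z = rip x z - rip y z.
Proof. by rewrite ripDl ripNl. Qed.

Lemma ripBr x y z : rip x (y - z) = rip x y - rip x z.
Proof. by rewrite ripDr ripNr. Qed.

Lemma ripZl (t : R) x y : rip (of_real t *: x) y = t * rip x y.
Proof. by rewrite /real_ip ipZl reZ. Qed.

Lemma ripZr (t : R) x y : rip x (of_real t *: y) = t * rip x y.
Proof. by rewrite /real_ip ipZr conj_of_real reZ. Qed.

Lemma rip0l y : rip 0 y = 0.
Proof. by rewrite /real_ip linear0l re0. Qed.

Lemma rip_rnorm x : rip x x = rnorm x ^+ 2.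
Proof.
by rewrite /real_ip ip_norm -of_real_rnorm expr2 -of_realM of_realK expr2.
Qed.

Lemma rnormD_sqr x y :
  rnorm (x + y) ^+ 2 = rnorm x ^+ 2 + 2 * rip x y + rnorm y ^+ 2.
Proof. by rewrite -!rip_rnorm ripDl !ripDr (ripC y x); ring. Qed.

(** Cauchy-Schwarz follows from the triangle inequality, which the norm already satisfies: expand |x
    + y|^2 <= (|x| + |y|)^2. *)
Lemma rip_le x y : rip x y <= rnorm x * rnorm y.
Proof.
have := rnorm_ge0 (x + y); have := rnormD x y.
have := rnormD_sqr x y; have := rnorm_ge0 x; have := rnorm_ge0 y.
move: (rnorm _) (rnorm x) (rnorm y) => c a b a0 b0 cE cab c0.
have : c ^+ 2 <= (a + b) ^+ 2 by rewrite lerXn2r // nnegrE addr_ge0.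
rewrite cE; lra.
Qed.

Lemma rip_ge x y : - (rnorm x * rnorm y) <= rip x y.
Proof. by rewrite lerNl -ripNl -(rnormN x) rip_le. Qed.

Lemma rip_eq0 x : (forall y, rip x y = 0) -> x = 0.
Proof.
move=> /(_ x); rewrite rip_rnorm => /eqP; rewrite sqrf_eq0 => /eqP.
exact: rnorm_eq0.
Qed.

(** Real parts suffice because A is stable under scalars: testing against <x, y> y gives |<x, y>|^2
    = 0. *)
Lemma orthcP A x : closed_subspace A ->
  (forall y, A y -> rip x y = 0) -> orthc ip A x.
Proof.
move=> A_sub xA y Ay; have := xA _ (@subspaceZ _ _ _ _ A_sub (ip x y) _ Ay).
rewrite /real_ip ipZr mulrC mulr_conj of_realK => /eqP.
by rewrite sqrf_eq0 => /eqP /rabs_eq0.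
Qed.

Lemma orthc_rip A x y : orthc ip A x -> A y -> rip x y = 0.
Proof. by move=> xA Ay; rewrite /real_ip xA ?re0. Qed.

Lemma orthc_linear A (a : K) x y : 
  orthc ip A x -> orthc ip A y -> orthc ip A (a *: x + y).
Proof.
by move=> xA yA z Az; rewrite ipDl ipZl xA // yA // mulr0 addr0.
Qed.

Lemma orthcB A x y : orthc ip A x -> orthc ip A y -> orthc ip A (x - y).
Proof. by move=> xA yA z Az; rewrite ipBl xA // yA // subr0. Qed.

Lemma orthc0 A : orthc ip A 0.
Proof. by move=> z _; rewrite linear0l. Qed.

Lemma orthc_self A x : A x -> orthc ip A x -> x = 0.
Proof.
move=> Ax xA; apply: rnorm_eq0; apply/eqP; rewrite -sqrf_eq0 -rip_rnorm.
by rewrite /real_ip xA ?re0.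
Qed.

Lemma rip_cvg (u : nat -> H) x y : u @ \oo --> x ->
  (fun n => rip (u n) y) @ \oo --> rip x y.
Proof.
move=> /cvg_rnormP ux; apply/cvgrPdist_le => e e0.
have d0 : 0 < e / (rnorm y + 1) by rewrite divr_gt0 // ltr_wpDl ?rnorm_ge0.
near=> n.
have : `|0 - rnorm (u n - x)| <= e / (rnorm y + 1).
  by near: n; move: ux => /cvgrPdist_le; exact.
rewrite sub0r normrN ger0_norm ?rnorm_ge0 //.
rewrite ler_pdivlMr ?ltr_wpDl ?rnorm_ge0 // => uxe.
rewrite distrC -ripBl.
have : `|rip (u n - x) y| <= rnorm (u n - x) * rnorm y.
  by rewrite ler_norml rip_ge rip_le.
move=> /le_trans; apply; apply: le_trans uxe.
by rewrite ler_wpM2l ?rnorm_ge0 // lerDl.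
Unshelve. all: by end_near. Qed.

End InnerProduct.

(** * Coercive problems, orthogonal projections, uniform boundedness *)

Section Hilbert.
Context {R : realType} {k : scalar_kind}.
Local Notation K := (scalars R k).
Context {H : completeNormedModType K}.
Variable ip : {dot H for @conj R k}.
Hypothesis ip_norm : forall x : H, ip x x = `|x| ^+ 2.
Implicit Types (x y z : H) (A E : set H).

Local Notation rip := (real_ip ip).

Lemma linear_appD (T : H -> H) x y : linear T -> T (x + y) = T x + T y.
Proof. by move=> linT; have := linT 1 x y; rewrite !scale1r. Qed.

Lemma linear_app0 (T : H -> H) : linear T -> T 0 = 0.
Proof.
move=> linT; have := linT (-1) 0 0.
by rewrite scaler0 addr0 scaleN1r addNr.
Qed.

Lemma linear_appZ (T : H -> H) (a : K) x : linear T -> T (a *: x) = a *: T x.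
Proof.
by move=> linT; have := linT a x 0; rewrite (linear_app0 linT) !addr0.
Qed.

Lemma linear_appB (T : H -> H) x y : linear T -> T (x - y) = T x - T y.
Proof.
by move=> linT; rewrite linear_appD // -scaleN1r linear_appZ // scaleN1r.
Qed.

(* The solution minimizes J x = <T x, x> - 2 Re <w, x> on E: a minimizing
   sequence is Cauchy by the parallelogram identity. *)
Lemma symmetric_coercive_solution E (T : H -> H) (a : R) (w : H) :
    closed_subspace E -> linear T ->
    (forall x y, E x -> E y -> rip (T x) y = rip x (T y)) ->
    0 < a -> (forall x, E x -> a * rnorm x ^+ 2 <= rip (T x) x) ->
  exists x, E x /\ orthc ip E (T x - w).
Proof.
move=> E_sub linT symT a0 coerT.
pose J x := rip (T x) x - 2 * rip w x.
have JD x y t : E x -> E y -> J (x + of_real t *: y) =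
    J x + 2 * t * (rip x (T y) - rip w y) + t ^+ 2 * rip (T y) y.
  move=> Ex Ey; rewrite /J linear_appD // linear_appZ //.
  rewrite !(ripDl, ripDr, ripZl, ripZr) -(symT _ _ Ex Ey).
  rewrite (ripC ip (T y) x) -(symT _ _ Ex Ey); ring.
have infJ : has_inf [set J x | x in E].
  split; first by exists (J 0), 0 => //; exact: subspace0.
  (* Completing the square in a |x|^2 - 2 |w| |x|, which bounds J from below. *)
  exists (- (rnorm w ^+ 2 / a)) => _ [x Ex <-].
  have := coerT x Ex; have := rip_le ip_norm w x; rewrite /J => wx Tx.
  have : 0 <= (a * rnorm x - rnorm w) ^+ 2 / a.
    by rewrite divr_ge0 ?sqr_ge0 ?ltW.
  have -> : (a * rnorm x - rnorm w) ^+ 2 / a =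
    a * rnorm x ^+ 2 - 2 * (rnorm w * rnorm x) + rnorm w ^+ 2 / a.
    by field; rewrite gt_eqF.
  lra.
set d := inf [set J x | x in E].
have dJ x : E x -> d <= J x by move=> Ex; apply: (ge_inf infJ.2); exists x.
have /choice[u uP] : forall n, exists x, E x /\ J x <= d + n.+1%:R^-1.
  move=> n; have [|_ [x Ex <-] xd] := @inf_adherent _ _ n.+1%:R^-1 _ infJ.
    by [].
  by exists x; split => //; exact: ltW.
have Eu n : E (u n) by case: (uP n).
have Ju n : J (u n) <= d + n.+1%:R^-1 by case: (uP n).
have EB x y : E x -> E y -> E (x - y) by exact: subspaceB.
have [x ux] : exists x, u @ \oo --> x.
  apply: rnorm_cauchy_cvg => e e0.
  (* With h = u m - u n, J at the midpoint is at least [d], so <T h, h> / 2 = J (u m) + J (u n) - 2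
     J (midpoint) <= 1/(m+1) + 1/(n+1). If both terms are below a e^2 / 4, then a |h|^2 <= <T h, h>
     <= a e^2. *)
  have c0 : 0 < a * e ^+ 2 / 4 by rewrite divr_gt0 // mulr_gt0 // exprn_gt0.
  have [N _ NP] := near_infty_natSinv_lt (PosNum c0).
  exists N => m n Nm Nn.
  have := NP _ Nm; have := NP _ Nn; rewrite /=.
  have := Ju m; have := Ju n.
  move: (n.+1%:R^-1) (m.+1%:R^-1) => en em Jn Jm hn hm.
  have := dJ _ (subspaceD E_sub (Eu n)
    (@subspaceZ _ _ _ _ E_sub (of_real 2^-1) _ (EB _ _ (Eu m) (Eu n)))).
  have Jm' : J (u m) = J (u n + of_real 1 *: (u m - u n)).
    by rewrite of_real1 scale1r addrC subrK.
  rewrite JD //; last exact: EB.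
  have := coerT _ (EB _ _ (Eu m) (Eu n)).
  move: Jm; rewrite Jm' JD //; last exact: EB.
  move: (rip (T (u m - u n)) _) (rip _ _ - rip _ _) (J (u n)) Jn.
  move=> q g j Jn Jm qa dj.
  have : a * rnorm (u m - u n) ^+ 2 <= a * e ^+ 2 by lra.
  by rewrite ler_pM2l // ler_sqr ?nnegrE ?rnorm_ge0 // ltW.
have Ex : E x by apply: closed_lim Eu ux; case: E_sub.
exists x; split=> //; apply: orthcP => // y Ey.
rewrite ripBl symT //.
set g := _ - _; set q := rip (T y) y.
have q0 : 0 <= q.
  by apply: le_trans (coerT y Ey); rewrite mulr_ge0 ?sqr_ge0 ?ltW.
have gt t : 0 <= 2 * t * g + t ^+ 2 * q.
  have cv : (fun n => n.+1%:R^-1 +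
      (2 * t * (rip (u n) (T y) - rip w y) + t ^+ 2 * q))
      @ \oo --> 0 + (2 * t * g + t ^+ 2 * q).
    apply: cvgD; first exact: cvg_harmonic.
    apply: cvgD; last exact: cvg_cst.
    apply: cvgMr; apply: cvgB; last exact: cvg_cst.
    exact: rip_cvg.
  rewrite -(add0r (_ + _)); apply: (cvgr_to_ge cv); apply: nearW => n.
  have := dJ _ (subspaceD E_sub (Eu n)
    (@subspaceZ _ _ _ _ E_sub (of_real t) _ Ey)).
  rewrite JD // -/q; have := Ju n => /=.
  move: (_^-1) (J _) (rip (u n) _ - _) => *; lra.
(* The minimum of 2 t g + t^2 q is at t = - g / q; the + 1 covers q = 0 and still gives a negative
   value unless g = 0. *)
have := gt (- g / (q + 1)).
have -> : 2 * (- g / (q + 1)) * g + (- g / (q + 1)) ^+ 2 * q =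
    - (g ^+ 2 * ((q + 2) / (q + 1) ^+ 2)) by field; rewrite gt_eqF // ltr_wpDl.
rewrite oppr_ge0 pmulr_lle0; last by rewrite divr_gt0 ?exprn_gt0 // ltr_wpDl.
move=> g2; apply/eqP; rewrite -sqrf_eq0; apply/eqP/le_anti.
by rewrite g2 sqr_ge0.
Qed.

Lemma orthogonal_decomposition E x : closed_subspace E ->
  exists y, E y /\ orthc ip E (x - y).
Proof.
move=> E_sub.
have id_coercive y : E y -> 1 * rnorm y ^+ 2 <= rip y y.
  by move=> _; rewrite mul1r rip_rnorm.
have [//|//|y [Ey yx]] :=
  symmetric_coercive_solution x E_sub (T := id) _ _ ltr01 id_coercive.
exists y; split=> // z Ez; have := yx z Ez; rewrite !ipBl => /eqP.
by rewrite subr_eq0 => /eqP ->; rewrite subrr.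
Qed.

Section Projection.
Variable E : set H.
Hypothesis E_sub : closed_subspace E.

Lemma orth_projection : exists P : H -> H,
  [/\ linear P, forall x, E (P x), forall x, orthc ip E (x - P x) &
      forall x, rnorm (P x) <= rnorm x].
Proof.
have /choice[P PP] := fun x => @orthogonal_decomposition E x E_sub.
have EP x : E (P x) by case: (PP x).
have oP x : orthc ip E (x - P x) by case: (PP x).
exists P; split=> //.
  (* Linearity by uniqueness: the defect lies in E and, as a combination of vectors z - P z, in
     E^perp. *)
  move=> a x y; apply/eqP; rewrite -subr_eq0; apply/eqP.
  apply: (orthc_self ip_norm (A := E)).
    by apply: subspaceB => //; exact: subspaceP.
  have -> : P (a *: x + y) - (a *: P x + P y) =
      (a *: (x - P x) + (y - P y)) - (a *: x + y - P (a *: x + y)).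
    rewrite scalerBr opprB.
    have -> : a *: x - a *: P x + (y - P y) = a *: x + y - (a *: P x + P y).
      by rewrite opprD addrACA.
    by rewrite [RHS]addrC addrA subrK.
  by apply: orthcB => //; exact: orthc_linear.
move=> x.
have : rnorm (P x) ^+ 2 <= rnorm x * rnorm (P x).
  rewrite -(rip_rnorm ip_norm) (le_trans _ (rip_le ip_norm _ _)) //.
  by rewrite -subr_ge0 -ripBl (orthc_rip (oP x)).
have [->|Px0] := eqVneq (rnorm (P x)) 0; first by rewrite rnorm_ge0.
by rewrite expr2 ler_pM2r // lt0r Px0 rnorm_ge0.
Qed.

Lemma orthc_orthc x : orthc ip (orthc ip E) x -> E x.
Proof.
move=> xEE; have [y [Ey xy]] := orthogonal_decomposition x E_sub.
suff -> : x = y by [].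
apply/eqP; rewrite -subr_eq0; apply/eqP; apply: (orthc_self ip_norm xy).
apply: orthcB => // z zE; rewrite ipC zE //.
by rewrite -(of_real0 (k := k)) conj_of_real.
Qed.

End Projection.

(* Gliding hump: x := sum_n +-3^-n v_n / |v_n| with signs that prevent
   cancellation in <x, v_n>, so that |<x, v_n>| >= 3^-n |v_n| / 2. *)
Lemma weakly_bounded_bounded A :
  (forall x, exists M : R, forall v, A v -> `|rip x v| <= M) ->
  exists C : R, forall v, A v -> rnorm v <= C.
Proof.
move=> wbA; apply: contrapT => ubA.
(* The growth n 3^n leaves n / 2 after the weight 3^-n and the loss of one half. *)
have /choice[v vP] : forall n, exists v, A v /\ n%:R * 3 ^+ n < rnorm v.
  move=> n; apply: contrapT => nv; apply: ubA; exists (n%:R * 3 ^+ n) => v Av.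
  by rewrite leNgt; apply/negP => lt_v; apply: nv; exists v.
pose q : R := 3^-1.
(* Here [x] will be the partial sum built so far; the sign makes the next term have nonnegative
   inner product with it. *)
pose sg x n := if 0 <= rip x (v n) then v n else - v n.
have rip_sg x n : 0 <= rip x (sg x n).
  rewrite /sg; case: ifPn => //; rewrite -ltNge ripNr oppr_ge0.
  exact: ltW.
have sgE x n y : `|rip y (v n)| = `|rip y (sg x n)|.
  by rewrite /sg; case: ifP => // _; rewrite ripNr normrN.
have rnorm_sg x n : rnorm (sg x n) = rnorm (v n).
  by rewrite /sg; case: ifP => // _; rewrite rnormN.
have v0 n : 0 < rnorm (v n).
  by case: (vP n) => _; apply: le_lt_trans; rewrite mulr_ge0 // exprn_ge0.
pose fix u n := if n is m.+1
  then u m + of_real (q ^+ m / rnorm (v m)) *: sg (u m) m else 0.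
have q0 : 0 <= q by rewrite invr_ge0.
have uS n : rnorm (u n.+1 - u n) <= q ^+ n.
  rewrite /= [X in X - _]addrC addrK rnormZ rabs_of_real rnorm_sg.
  by rewrite ger0_norm ?divr_ge0 ?exprn_ge0 ?rnorm_ge0 // divfK // gt_eqF.
have uB n m : rnorm (u (n + m)%N - u n) <= 3 / 2 * (q ^+ n - q ^+ (n + m)).
  elim: m => [|m IHm]; first by rewrite addn0 !subrr rnorm0 mulr0.
  rewrite -(subrK (u (n + m)%N) (u _)) -addrA.
  apply: (le_trans (rnormD _ _)); apply: (le_trans (lerD _ IHm)).
    by rewrite addnS; exact: uS.
  rewrite addnS exprS; move: (q ^+ n) (q ^+ (n + m)) => s t; rewrite /q; lra.
have uB' n m : (n <= m)%N -> rnorm (u m - u n) <= 3 / 2 * q ^+ n.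
  move=> /subnKC <-; apply: (le_trans (uB _ _)).
  by rewrite ler_wpM2l // gerBl exprn_ge0.
have [x ux] : exists x, u @ \oo --> x.
  apply: rnorm_cauchy_cvg => e e0.
  (* The constant 3 is the sum of two tails, each at most 3/2 q^N. *)
  have /cvgrPdist_le/(_ e e0) : (geometric 3 q : nat -> R) @ \oo --> (0 : R).
    by apply: cvg_geometric; rewrite ger0_norm // /q invf_lt1 // ltr1n.
  case=> N _ NP; exists N => m n Nm Nn.
  have := NP _ (leqnn N); rewrite /= sub0r normrN.
  rewrite ger0_norm ?mulr_ge0 ?exprn_ge0 // => /(le_trans _); apply.
  rewrite -(subrK (u N) (u m)) -addrA (le_trans (rnormD _ _)) //.
  have := uB' _ _ Nm; have := uB' _ _ Nn; rewrite (rnormC (u N)).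
  move: (rnorm _) (rnorm _) (q ^+ N) => b c z; lra.
have [M MP] := wbA x.
have half n : n%:R / 2 <= M.
  have [Avn vn] := vP n.
  apply: le_trans (MP _ Avn); rewrite (sgE (u n)).
  apply: le_trans (ler_norm _).
  have cv := rip_cvg ip_norm (y := sg (u n) n) ux.
  apply: (cvgr_to_ge cv).
  exists n.+1 => // m /= nm.
  (* The inner product splits into <u n, sg> >= 0, the term q^n |v n|, and a tail of size at most
     3/2 q^(n+1) |v n| = q^n |v n| / 2, as q = 1/3. What is left is at least q^n |v n| / 2 >= n /
     2. *)
  have -> : u m = u n.+1 + (u m - u n.+1) by rewrite addrC subrK.
  rewrite ripDl /= ripDl ripZl (rip_rnorm ip_norm) rnorm_sg.
  have := rip_ge ip_norm (u m - u n.+1) (sg (u n) n); rewrite rnorm_sg.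
  have := uB' _ _ nm; have := rip_sg (u n) n.
  have -> : q ^+ n / rnorm (v n) * rnorm (v n) ^+ 2 = q ^+ n * rnorm (v n).
    by rewrite expr2 mulrA divfK // gt_eqF.
  have nq : n%:R <= q ^+ n * rnorm (v n).
    rewrite /q exprVn ler_pdivlMl ?exprn_gt0 // mulrC; exact: ltW.
  rewrite exprS; move: (rip _ _) => s; move: (rnorm _) => t.
  rewrite -/(u n.+1); move: (rip _ _) => s' s0 t0 s'0.
  have : t * rnorm (v n) <= 3 / 2 * (q * q ^+ n) * rnorm (v n).
    by rewrite ler_pM2r.
  have -> : 3 / 2 * (q * q ^+ n) * rnorm (v n) = (q ^+ n * rnorm (v n)) / 2.
    by rewrite /q; field.
  lra.
have := half (Num.truncn (2 * M)).+1; rewrite leNgt => /negP; apply.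
by rewrite ltr_pdivlMr // mulrC truncnS_gt.
Qed.

End Hilbert.

(** * Operator norm and the two oblique projections *)

Section Oblique.
Context {R : realType} {k : scalar_kind}.
Local Notation K := (scalars R k).
Context {H : completeNormedModType K}.
Variable ip : {dot H for @conj R k}.
Hypothesis ip_norm : forall x : H, ip x x = `|x| ^+ 2.
Implicit Types (x y z : H) (A B W V : set H).

Local Notation rip := (real_ip ip).

Lemma opnorm_le (T : H -> H) (C : R) :
  (forall x, rnorm x <= 1 -> rnorm (T x) <= C) -> (opnorm T <= C%:E)%E.
Proof.
by move=> TC; apply: ge_ereal_sup => _ [x x1 <-]; rewrite lee_fin TC.
Qed.

(** The bound [C] makes the supremum finite; with an infinite one [fine] would return 0 and the
    claim could fail. *)
Lemma rnorm_le_opnorm (T : H -> H) (C : R) x :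
  (forall (t : R) y, T (of_real t *: y) = of_real t *: T y) ->
  (forall y, rnorm (T y) <= C * rnorm y) ->
  rnorm (T x) <= fine (opnorm T) * rnorm x.
Proof.
move=> TZ TC.
have le_op y : rnorm y <= 1 -> ((rnorm (T y))%:E <= opnorm T)%E.
  by move=> y1; apply: ereal_sup_ubound; exists y.
have op_fin : opnorm T = (fine (opnorm T))%:E.
  rewrite fineK // fin_numElt; apply/andP; split.
    by apply: lt_le_trans (le_op 0 _); rewrite ?rnorm0 ?ltNyr.
  apply: (@le_lt_trans _ _ `|C|%:E); last exact: ltry.
  apply: opnorm_le => y y1; apply: (le_trans (TC y)).
  apply: (@le_trans _ _ (`|C| * rnorm y)).
    by rewrite ler_wpM2r ?rnorm_ge0 ?ler_norm.
  by rewrite ler_piMr.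
have [x0|x0] := eqVneq (rnorm x) 0.
  by rewrite (le_trans (TC x)) // x0 !mulr0.
have xgt0 : 0 < rnorm x by rewrite lt0r x0 rnorm_ge0.
have : ((rnorm (T (of_real (rnorm x)^-1 *: x)))%:E <= opnorm T)%E.
  apply: le_op; rewrite rnormZ rabs_of_real ger0_norm ?invr_ge0 ?(ltW xgt0) //.
  by rewrite mulVf.
rewrite op_fin lee_fin TZ rnormZ rabs_of_real ger0_norm ?invr_ge0 ?(ltW xgt0) //.
by rewrite ler_pdivrMl // mulrC.
Qed.

Lemma oblique_projP A B x : direct_sum A B ->
  A (oblique_proj A B x) /\ B (x - oblique_proj A B x).
Proof.
move=> [_ /(_ x)[a [b [Aa Bb xab]]]].
apply: (xgetPex 0 (P := [set a | A a /\ B (x - a)])).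
by exists a; split=> //; rewrite xab addrAC subrr add0r.
Qed.

Lemma oblique_proj_eq A B x a :
  closed_subspace A -> direct_sum A (orthc ip B) ->
  A a -> orthc ip B (x - a) -> oblique_proj A (orthc ip B) x = a.
Proof.
move=> A_sub AB Aa xa; have [Ap xp] := oblique_projP x AB.
apply/eqP; rewrite -subr_eq0; apply/eqP.
have : (A `&` orthc ip B) (oblique_proj A (orthc ip B) x - a).
  split; first exact: subspaceB.
  have -> : oblique_proj A (orthc ip B) x - a =
      (x - a) - (x - oblique_proj A (orthc ip B) x).
    by rewrite opprB [RHS]addrC subrKA.
  exact: orthcB.
by case: AB => -> _.
Qed.

Lemma oblique_projZ A B (c : K) x :
  closed_subspace A -> direct_sum A (orthc ip B) ->
  oblique_proj A (orthc ip B) (c *: x) = c *: oblique_proj A (orthc ip B) x.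
Proof.
move=> A_sub AB; have [Ap xp] := oblique_projP x AB.
apply: oblique_proj_eq => //; first exact: subspaceZ.
rewrite -scalerBr -[_ *: _]addr0; apply: orthc_linear => //.
exact: orthc0.
Qed.

Section Dual.
Variables W V : set H.
Hypotheses (W_sub : closed_subspace W) (V_sub : closed_subspace V).
Hypothesis WV : direct_sum W (orthc ip V).

Local Notation pi_WV := (oblique_proj W (orthc ip V)).
Local Notation pi_VW := (oblique_proj V (orthc ip W)).

(** Such an [x] is orthogonal to W and, lying in V, also to V^perp; these two span H. *)
Lemma orthc_trivial x : V x -> orthc ip W x -> x = 0.
Proof.
move=> Vx xW; apply: (rip_eq0 ip_norm) => y.
have [_ /(_ y)[w [u [Ww Vu ->]]]] := WV.
by rewrite ripDr (orthc_rip xW Ww) (ripC ip x u) (orthc_rip Vu Vx) addr0.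
Qed.

(* Uniform boundedness applied to the v in V with |P v| <= 1: for x = w + u with
   w in W and u orthogonal to V, <x, v> = <w, v> = <w, P v>. *)
Lemma projection_bounded_below (P : H -> H) : linear P ->
  (forall x, W (P x)) -> (forall x, orthc ip W (x - P x)) ->
  exists2 C : R, 0 < C & forall v, V v -> rnorm v <= C * rnorm (P v).
Proof.
move=> linP WP oP.
have [x|C bC] := weakly_bounded_bounded ip_norm
    (A := [set v | V v /\ rnorm (P v) <= 1]).
  have [_ /(_ x)[w [u [Ww Vu ->]]]] := WV.
  exists (rnorm w) => v [Vv Pv1].
  have -> : rip (w + u) v = rip w (P v).
    rewrite ripDl (orthc_rip Vu Vv) addr0; apply/eqP; rewrite -subr_eq0.
    by rewrite -ripBr ripC (orthc_rip (oP v) Ww).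
  rewrite ler_norml; apply/andP; split.
    apply: le_trans (rip_ge ip_norm _ _).
    by rewrite lerN2 ler_piMr ?rnorm_ge0.
  by apply: (le_trans (rip_le ip_norm _ _)); rewrite ler_piMr ?rnorm_ge0.
exists (`|C| + 1); first by rewrite ltr_wpDl.
move=> v Vv; have [Pv0|Pv0] := eqVneq (rnorm (P v)) 0.
  rewrite Pv0 mulr0 (_ : v = 0) ?rnorm0 //.
  by apply: orthc_trivial => //; rewrite -(subr0 v) -(rnorm_eq0 Pv0).
have Pv_gt0 : 0 < rnorm (P v) by rewrite lt0r Pv0 rnorm_ge0.
have := bC (of_real (rnorm (P v))^-1 *: v).
rewrite /= linear_appZ // !rnormZ rabs_of_real gtr0_norm ?invr_gt0 // mulVf //.
move=> h; have {h} := h (Logic.conj (subspaceZ V_sub _ Vv) (lexx _)).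
rewrite ler_pdivrMl // mulrC => /le_trans; apply.
by rewrite ler_wpM2r ?rnorm_ge0 // (le_trans (ler_norm C)) // lerDl.
Qed.

(** For given x, the coercive problem on V yields v in V with P v - P x orthogonal to V; this vector
    also lies in W, so it vanishes and x - v is in W^perp. Since P (pi' x) = P x, the lower bound of
    P on V bounds pi' with the same [C]. *)
Lemma direct_sum_adjoint : direct_sum V (orthc ip W) /\
  exists C : R, forall x, rnorm (pi_VW x) <= C * rnorm x.
Proof.
have [P [linP WP oP nP]] := orth_projection ip_norm W_sub.
have [C C0 bC] := projection_bounded_below linP WP oP.
have ripP x y : rip (P x) y = rip (P x) (P y).
  by apply/eqP; rewrite -subr_eq0 -ripBr ripC (orthc_rip (oP y) (WP x)).
have P_orth x : orthc ip W x -> P x = 0.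
  move=> xW; apply: (orthc_self ip_norm (WP x)).
  have -> : P x = x - (x - P x) by rewrite opprB addrC subrK.
  exact: orthcB.
have VW : direct_sum V (orthc ip W).
  split.
    rewrite eqEsubset; split=> [x [Vx xW]|_ ->] /=; first exact: orthc_trivial.
    by split; [exact: subspace0 | exact: orthc0].
  move=> x.
  have coerP v : V v -> C ^- 2 * rnorm v ^+ 2 <= rip (P v) v.
    move=> Vv; rewrite ripP (rip_rnorm ip_norm) ler_pdivrMl ?exprn_gt0 //.
    by rewrite -exprMn ler_sqr ?nnegrE ?mulr_ge0 ?rnorm_ge0 ?(ltW C0) // bC.
  have symP y z : V y -> V z -> rip (P y) z = rip y (P z).
    by rewrite (ripP y) (ripC ip y) (ripP z) ripC.
  have C2 : 0 < C ^- 2 by rewrite invr_gt0 exprn_gt0.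
  have [v [Vv vx]] :=
    symmetric_coercive_solution ip_norm (P x) V_sub linP symP C2 coerP.
  exists v, (x - v); split=> //; last by rewrite addrC subrK.
  have Pvx : P (x - v) = 0.
    have : (W `&` orthc ip V) (P v - P x) by split=> //; exact: subspaceB.
    case: WV => -> _ /= vx0.
    by apply/eqP; rewrite linear_appB // subr_eq0 eq_sym -subr_eq0 vx0.
  by rewrite -(subr0 (x - v)) -Pvx.
split=> //; exists C => x; have [Vp xp] := oblique_projP x VW.
apply: (le_trans (bC _ Vp)); rewrite ler_wpM2l ?(ltW C0) //.
have /eqP := P_orth _ xp; rewrite linear_appB // subr_eq0 => /eqP <-.
exact: nP.
Qed.

Lemma rnorm_pi_VW x :
  rnorm (pi_VW x) <= fine (opnorm pi_VW) * rnorm x.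
Proof.
have [VW [C bC]] := direct_sum_adjoint.
apply: (rnorm_le_opnorm x _ bC) => t y; exact: oblique_projZ.
Qed.

(** Both sides equal <pi x, pi' y>: y - pi' y is orthogonal to W, and x - pi x to V. *)
Lemma pi_adjoint x y : ip (pi_WV x) y = ip x (pi_VW y).
Proof.
have [VW _] := direct_sum_adjoint.
have [Ww xw] := oblique_projP x WV; have [Vv yv] := oblique_projP y VW.
transitivity (ip (pi_WV x) (pi_VW y)); apply/eqP.
  rewrite -subr_eq0 -ipBr ipC yv //.
  by rewrite -(of_real0 (k := k)) conj_of_real.
by rewrite eq_sym -subr_eq0 -ipBl xw.
Qed.

(** The bound on r involves the norm of the adjoint, so pi is measured by it: |pi x|^2 = <x, pi' (pi
    x)>, then Cauchy-Schwarz. *)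
Lemma rnorm_pi_WV x :
  rnorm (pi_WV x) <= fine (opnorm pi_VW) * rnorm x.
Proof.
have [->|w0] := eqVneq (rnorm (pi_WV x)) 0.
  apply: le_trans (rnorm_ge0 _) (rnorm_pi_VW x).
have w_gt0 : 0 < rnorm (pi_WV x) by rewrite lt0r w0 rnorm_ge0.
rewrite -(ler_pM2r w_gt0) -expr2 -(rip_rnorm ip_norm) /real_ip pi_adjoint.
apply: (le_trans (rip_le ip_norm x _)).
by rewrite mulrAC [leRHS]mulrC ler_wpM2l ?rnorm_ge0 ?rnorm_pi_VW.
Qed.

(** On V one has |x|^2 = <pi x, x>. This is the source of the lower frame bound of the dual. *)
Lemma rnorm_le_pi_WV x : V x -> rnorm x <= rnorm (pi_WV x).
Proof.
move=> Vx; have [Ww xw] := oblique_projP x WV.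
have [->|x0] := eqVneq (rnorm x) 0; first exact: rnorm_ge0.
have x_gt0 : 0 < rnorm x by rewrite lt0r x0 rnorm_ge0.
rewrite -(ler_pM2r x_gt0) -expr2 -(rip_rnorm ip_norm).
apply: le_trans (rip_le ip_norm _ _).
by rewrite -subr_le0 -ripBl (orthc_rip xw Vx).
Qed.

Lemma opnorm_pi_VW_ge0 : 0 <= fine (opnorm pi_VW).
Proof.
rewrite /opnorm fine_ge0 //.
apply: ereal_sup_ge; exists (rnorm (pi_VW 0))%:E; last by rewrite lee_fin rnorm_ge0.
by exists 0 => //=; rewrite rnorm0.
Qed.

(** A projection fixes its range, and V = 0 would give V^perp = H, hence W = 0. The lower bound 1
    makes r < alpha strict. *)
Lemma opnorm_pi_VW_ge1 : W <> [set 0] -> 1 <= fine (opnorm pi_VW).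
Proof.
move=> W0; have [VW _] := direct_sum_adjoint.
have [v [Vv v0]] : exists v, V v /\ v <> 0.
  apply: contrapT => nov; apply: W0; rewrite eqEsubset.
  split=> [w Ww|_ ->]; last exact: subspace0.
  have : (W `&` orthc ip V) w.
    split=> // v Vv; have -> : v = 0 by apply: contrapT => v0; apply: nov; exists v.
    by rewrite linear0r.
  by case: WV => -> _.
have := rnorm_pi_VW v; rewrite (oblique_proj_eq V_sub VW Vv); last first.
  by rewrite subrr; exact: orthc0.
rewrite -{1}(mul1r (rnorm v)) ler_pM2r // lt0r rnorm_ge0 andbT.
by apply/eqP => /rnorm_eq0.
Qed.

End Dual.
End Oblique.

(** * Frame sums, Bessel sequences and convergence of synthesis *)

Section Frames.
Context {R : realType} {k : scalar_kind}.
Local Notation K := (scalars R k).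
Context {H : completeNormedModType K}.
Variable ip : {dot H for @conj R k}.
Hypothesis ip_norm : forall x : H, ip x x = `|x| ^+ 2.
Implicit Types (x y z : H) (W : set H) (f : nat -> H) (c : nat -> K).

Local Notation rip := (real_ip ip).

Definition frame_psum f x N : R := \sum_(0 <= n < N) rabs (ip x (f n)) ^+ 2.

(** Asked on all of H, unlike a frame bound; [bessel_subspace] extends it from the subspace. *)
Definition bessel f (B : R) := forall x N, frame_psum f x N <= B * rnorm x ^+ 2.

Lemma frame_sum_leP f x (b : R) :
  (frame_sum ip f x <= b%:E)%E <-> forall N, frame_psum f x N <= b.
Proof.
have ge0 n : (0 <= n)%N -> true -> (0 <= (rabs (ip x (f n)) ^+ 2)%:E :> \bar R)%E.
  by rewrite lee_fin sqr_ge0.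
split=> [le_b N|le_b].
  rewrite -lee_fin; apply: le_trans le_b.
  by rewrite -sumEFin; exact: nneseries_lim_ge.
apply: lime_le; first exact: is_cvg_nneseries.
by apply: nearW => N; rewrite sumEFin lee_fin; exact: le_b.
Qed.

(** Expressing lower bounds through real upper bounds of the partial sums keeps the frame
    inequalities in R; for an infinite sum the right side holds vacuously. *)
Lemma frame_sum_geP f x (m : R) :
  (m%:E <= frame_sum ip f x)%E <->
  forall b, (forall N, frame_psum f x N <= b) -> m <= b.
Proof.
split=> [m_le b /frame_sum_leP|m_le].
  by rewrite -lee_fin; exact: le_trans.
case E : (frame_sum ip f x) => [s| |]; last 2 first.
- by rewrite leey.
- have := leey (frame_sum ip f x); have : (0 <= frame_sum ip f x)%E.
    by apply: nneseries_ge0 => n _ _; rewrite lee_fin sqr_ge0.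
  by rewrite E.
by rewrite lee_fin; apply: m_le; apply/frame_sum_leP; rewrite E.
Qed.

Lemma frame_psum_nondecreasing f x m n :
  (m <= n)%N -> frame_psum f x m <= frame_psum f x n.
Proof.
move=> mn; rewrite /frame_psum (big_cat_nat (leq0n m) mn) //= lerDl.
by apply: sumr_ge0 => i _; exact: sqr_ge0.
Qed.

(** The vectors f n lie in W, so x and its orthogonal projection onto W have the same coefficients,
    and projecting does not increase the norm. *)
Lemma bessel_subspace W f (B : R) : closed_subspace W -> 0 <= B ->
  (forall n, W (f n)) ->
  (forall x, W x -> forall N, frame_psum f x N <= B * rnorm x ^+ 2) ->
  bessel f B.
Proof.
move=> W_sub B0 Wf fB x N.
have [P [linP WP oP nP]] := orth_projection ip_norm W_sub.
have -> : frame_psum f x N = frame_psum f (P x) N.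
  apply: eq_bigr => n _; congr (rabs _ ^+ 2).
  by apply/eqP; rewrite -subr_eq0 -ipBl oP.
apply: (le_trans (fB _ (WP x) N)); rewrite ler_wpM2l //.
by rewrite ler_sqr ?nnegrE ?rnorm_ge0.
Qed.

(** Duality between synthesis and analysis: |s|^2 is the real part of sum c_n <f_n, s>, split by 2 b
    |c d| <= b^2 |c|^2 + |d|^2; the Bessel bound lets the second part be absorbed on the left. *)
Lemma rnorm_sum_sqr_le f (B : R) c m p : bessel f B -> 0 <= B ->
  rnorm (\sum_(m <= n < p) c n *: f n) ^+ 2 <=
  B * \sum_(m <= n < p) rabs (c n) ^+ 2.
Proof.
move=> fB B0; set s := \sum_(m <= n < p) _; set C := \sum_(m <= n < p) _.
have C0 : 0 <= C by apply: sumr_ge0 => i _; exact: sqr_ge0.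
have sB : \sum_(m <= n < p) rabs (ip s (f n)) ^+ 2 <= B * rnorm s ^+ 2.
  have [pm|mp] := leqP p m; first by rewrite big_geq // mulr_ge0 ?sqr_ge0.
  apply: le_trans (fB s p); rewrite /frame_psum (big_cat_nat (leq0n m) (ltnW mp)) //=.
  by rewrite lerDr sumr_ge0 // => i _; exact: sqr_ge0.
apply/ler_addgt0Pr => e e0.
have C1 : 0 < C + 1 by rewrite ltr_wpDl.
(* [B] may be 0 (later it is [r]), so it is raised to a positive [b] at a cost of at most [e]. *)
pose b := B + e / (C + 1).
have b0 : 0 < b by rewrite ltr_wpDl // divr_gt0.
have bC : b * C <= B * C + e.
  rewrite mulrDl lerD2l mulrAC ler_pdivrMr // ler_wpM2l ?(ltW e0) //.
  by rewrite lerDl.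
apply: le_trans bC.
have sb : \sum_(m <= n < p) rabs (ip s (f n)) ^+ 2 <= b * rnorm s ^+ 2.
  by apply: (le_trans sB); rewrite ler_wpM2r ?sqr_ge0 // lerDl divr_ge0 // ltW.
have : 2 * b * rnorm s ^+ 2 <= b ^+ 2 * C + \sum_(m <= n < p) rabs (ip s (f n)) ^+ 2.
  rewrite -(rip_rnorm ip_norm) {1}/s /real_ip ip_suml re_sum.
  rewrite !mulr_sumr -big_split /=; apply: ler_sum => n _.
  rewrite ipZl.
  have cd : re (c n * ip (f n) s) <= rabs (c n) * rabs (ip s (f n)).
    by rewrite (ipC ip s) rabs_conj -rabsM; exact: re_le_rabs.
  apply: (@le_trans _ _ (2 * b * (rabs (c n) * rabs (ip s (f n))))).
    by rewrite ler_wpM2l // mulr_ge0 // ltW.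
  have := sqr_ge0 (b * rabs (c n) - rabs (ip s (f n))); nra.
move: sb; move: (\sum_(m <= n < p) rabs (ip s (f n)) ^+ 2) => D sb h.
rewrite -(ler_pM2l b0); move: h sb; rewrite expr2; nra.
Qed.

Lemma rnorm_lim_le (u : nat -> H) x (c : R) :
  u @ \oo --> x -> (forall n, rnorm (u n) <= c) -> rnorm x <= c.
Proof.
move=> /cvg_rnormP ux uc.
have cv : (fun n => c + rnorm (u n - x)) @ \oo --> c + 0.
  by apply: cvgD ux; exact: cvg_cst.
rewrite -(addr0 c); apply: (cvgr_to_ge cv); apply: nearW => n.
rewrite -{1}(subrK (u n) x) addrC; apply: (le_trans (rnormD _ _)).
by rewrite (rnormC x) lerD2r.
Qed.

Lemma synthesis_cvg f (B M : R) c : bessel f B -> 0 <= B ->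
  (forall N, \sum_(0 <= n < N) rabs (c n) ^+ 2 <= M) ->
  series (fun n => c n *: f n) @ \oo --> synthesis f c.
Proof.
move=> fB B0 cM.
have [s cs] : exists s : H, series (fun n => c n *: f n) @ \oo --> s; last first.
  rewrite /synthesis (_ : lim _ = s) //.
  by apply: cvg_lim => //; exact: norm_hausdorff.
apply: rnorm_cauchy_cvg => e e0.
pose S := series (fun n => rabs (c n) ^+ 2).
have S_nd : nondecreasing_seq S.
  by apply: nondecreasing_series => n _ _; exact: sqr_ge0.
have S_cvg : cvgn S.
  apply: nondecreasing_is_cvgn => //.
  by exists M => _ [n _ <-]; exact: cM.
(* A tail of sum |c_n|^2 of this size, multiplied by [B], is at most e^2; the + 1 covers B = 0. *)
have d0 : 0 < e ^+ 2 / (B + 1) by rewrite divr_gt0 ?exprn_gt0 // ltr_wpDl.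
have /cvgrPdist_le/(_ _ d0)[N _ NP] := S_cvg.
have main m n : (N <= m)%N -> (m <= n)%N ->
    rnorm (series (fun n => c n *: f n) n - series (fun n => c n *: f n) m) <= e.
  move=> Nm mn; rewrite sub_series_geq //.
  rewrite -ler_sqr ?nnegrE ?rnorm_ge0 ?(ltW e0) //.
  apply: (le_trans (rnorm_sum_sqr_le _ _ _ fB B0)).
  have -> : \sum_(m <= n0 < n) rabs (c n0) ^+ 2 = S n - S m.
    by rewrite sub_series_geq.
  have := NP _ Nm; rewrite /= ger0_norm ?subr_ge0; last exact: nondecreasing_cvgn_le.
  have := nondecreasing_cvgn_le S_nd S_cvg n.
  rewrite ler_pdivlMr ?ltr_wpDl //; move: (limn S) => l Sl Sm.
  have Smn : S m <= S n by exact: S_nd.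
  by apply: le_trans Sm; rewrite mulrC; apply: ler_pM; rewrite ?subr_ge0 ?lerD2r ?lerDl.
exists N => m n Nm Nn; have [mn|/ltnW nm] := leqP m n; last exact: main.
by rewrite rnormC; exact: main.
Qed.

Lemma rnorm_synthesis_le f (B M : R) c : bessel f B -> 0 <= B ->
  (forall N, \sum_(0 <= n < N) rabs (c n) ^+ 2 <= M) ->
  rnorm (synthesis f c) ^+ 2 <= B * M.
Proof.
move=> fB B0 cM.
have BM0 : 0 <= B * M.
  by rewrite mulr_ge0 //; have := cM 0%N; rewrite big_geq.
rewrite -(sqr_sqrtr BM0) ler_sqr ?nnegrE ?rnorm_ge0 ?sqrtr_ge0 //.
apply: rnorm_lim_le (synthesis_cvg fB B0 cM) _ => n.
rewrite -ler_sqr ?nnegrE ?rnorm_ge0 ?sqrtr_ge0 // sqr_sqrtr //.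
by apply: (le_trans (rnorm_sum_sqr_le _ _ _ fB B0)); rewrite ler_wpM2l.
Qed.

Lemma cvg_unique_seq (u : nat -> H) x y : u @ \oo --> x -> u @ \oo --> y -> x = y.
Proof. exact: (cvg_unique (@norm_hausdorff _ H)). Qed.

End Frames.

Lemma eq_cvgn (T : topologicalType) (u v : nat -> T) (l : T) :
  (forall n, v n = u n) -> u @ \oo --> l -> v @ \oo --> l.
Proof. by move=> /funext ->. Qed.

(** * The frame operator and its Moore-Penrose inverse *)

Section FrameOperator.
Context {R : realType} {k : scalar_kind}.
Local Notation K := (scalars R k).
Context {H : completeNormedModType K}.
Variable ip : {dot H for @conj R k}.
Hypothesis ip_norm : forall x : H, ip x x = `|x| ^+ 2.
Implicit Types (x y z : H).

Local Notation rip := (real_ip ip).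

(** Symmetry of real parts is enough over C as well: applied to conj d x, with d the defect, it
    gives |d|^2 = 0. *)
Lemma rip_self_adjoint (T : H -> H) : linear T ->
  (forall x y, rip (T x) y = rip x (T y)) -> self_adjoint ip T.
Proof.
move=> linT symT x y; apply/eqP; rewrite -subr_eq0; apply/eqP.
set d := _ - _; apply: rabs_eq0; apply/eqP; rewrite -sqrf_eq0; apply/eqP.
apply: (@of_real_inj _ k); rewrite -mulr_conj of_real0.
have : re (conj d * d) = 0.
  rewrite /d mulrBr -!ipZl -linear_appZ // reB; apply/eqP; rewrite subr_eq0.
  by apply/eqP; exact: symT.
by rewrite mulrC mulr_conj of_realK => ->; rewrite of_real0.
Qed.

Lemma projection_self_adjoint (E : set H) (Q : H -> H) :
  (forall x, E (Q x)) -> (forall x, orthc ip E (x - Q x)) -> self_adjoint ip Q.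
Proof.
move=> EQ oQ x y; transitivity (ip (Q x) (Q y)); apply/eqP.
  rewrite -subr_eq0 -ipBr ipC oQ //.
  by rewrite -(of_real0 (k := k)) conj_of_real.
by rewrite eq_sym -subr_eq0 -ipBl oQ.
Qed.

Variables (W : set H) (f : nat -> H) (a b : R).
Hypotheses (W_sub : closed_subspace W) (f_frame : frame_bounds ip W f a b).

Local Notation S := (synthesis f \o analysis ip f).

Lemma frame_mem n : W (f n).
Proof. by case: f_frame. Qed.

Lemma frame_lower_gt0 : 0 < a.
Proof. by case: f_frame. Qed.

Lemma frame_upper_gt0 : 0 < b.
Proof. by case: f_frame => _ a0 ab _; exact: lt_le_trans ab. Qed.

Lemma frame_bessel : bessel ip f b.
Proof.
case: f_frame => _ _ _ fab.
apply: bessel_subspace W_sub (ltW frame_upper_gt0) frame_mem _ => // x Wx.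
by apply/frame_sum_leP; case: (fab x Wx).
Qed.

Lemma frame_operator_cvg x :
  series (fun n => ip x (f n) *: f n) @ \oo --> S x.
Proof.
exact: (synthesis_cvg ip_norm (c := analysis ip f x)
  frame_bessel (ltW frame_upper_gt0) (frame_bessel x)).
Qed.

Lemma frame_operator_mem x : W (S x).
Proof.
have cl : closed W by case: W_sub.
apply: (closed_lim cl) (@frame_operator_cvg x) => n.
by apply: subspace_sum => // i; apply: subspaceZ => //; exact: frame_mem.
Qed.

Lemma frame_operator_linear : linear S.
Proof.
move=> c x y; apply: (cvg_unique_seq (@frame_operator_cvg _)).
apply: eq_cvgn (cvgD (cvgZr (k := c) (@frame_operator_cvg x))
  (@frame_operator_cvg y)) => n.
rewrite fctE /series /= scaler_sumr -big_split /=.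
by apply: eq_bigr => i _; rewrite scalerA -scalerDl ipDl ipZl.
Qed.

Lemma rip_frame_operator_cvg x y :
  (fun N => \sum_(0 <= n < N) re (ip x (f n) * ip (f n) y)) @ \oo --> rip (S x) y.
Proof.
apply: eq_cvgn (rip_cvg ip_norm (y := y) (@frame_operator_cvg x)) => N.
rewrite /real_ip /series /= ip_suml re_sum.
by apply: eq_bigr => n _; rewrite ipZl.
Qed.

Lemma rip_frame_operator_sym x y : rip (S x) y = rip x (S y).
Proof.
apply: (cvg_unique (@norm_hausdorff _ R^o) (@rip_frame_operator_cvg _ _)).
rewrite ripC; apply: eq_cvgn (@rip_frame_operator_cvg y x) => N.
apply: eq_bigr => n _.
by rewrite -re_conj conjM -(ipC ip _ x) -(ipC ip y) mulrC.
Qed.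

Lemma frame_operator_self_adjoint : self_adjoint ip S.
Proof.
exact: rip_self_adjoint frame_operator_linear rip_frame_operator_sym.
Qed.

Lemma frame_psum_le_rip x N : frame_psum ip f x N <= rip (S x) x.
Proof.
apply: (cvgr_to_ge (@rip_frame_operator_cvg x x)).
exists N => // M /= NM; apply: le_trans (frame_psum_nondecreasing _ _ _ NM) _.
apply: ler_sum => n _; rewrite (ipC ip (f n)) mulr_conj of_realK.
exact: lexx.
Qed.

Lemma rip_frame_operator_le x (M : R) :
  (forall N, frame_psum ip f x N <= M) -> rip (S x) x <= M.
Proof.
move=> xM; apply: (cvgr_to_le (@rip_frame_operator_cvg x x)).
apply: nearW => N; apply: le_trans (xM N); apply: ler_sum => n _.
by rewrite (ipC ip (f n)) mulr_conj of_realK.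
Qed.

Lemma frame_operator_coercive x : W x -> a * rnorm x ^+ 2 <= rip (S x) x.
Proof.
case: f_frame => _ _ _ fab /fab[/frame_sum_geP le_a _].
by apply: le_a => N; exact: frame_psum_le_rip.
Qed.

Lemma rnorm_frame_operator_le x : rnorm (S x) <= b * rnorm x.
Proof.
have b0 := ltW frame_upper_gt0.
rewrite -ler_sqr ?nnegrE ?mulr_ge0 ?rnorm_ge0 // exprMn expr2 -mulrA.
exact: (rnorm_synthesis_le ip_norm (c := analysis ip f x)
  frame_bessel b0 (frame_bessel x)).
Qed.

Lemma frame_operator_orthc x : orthc ip W x -> S x = 0.
Proof.
move=> xW; apply: (cvg_unique_seq (@frame_operator_cvg _)).
rewrite (_ : series _ = cst 0); first exact: cvg_cst.
apply/funext => n; rewrite /series /= big1 // => i _.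
by rewrite xW ?scale0r //; exact: frame_mem.
Qed.

Lemma frame_operator_eq0 x : W x -> S x = 0 -> x = 0.
Proof.
move=> Wx Sx0; have := frame_operator_coercive Wx.
rewrite Sx0 rip0l pmulr_rle0 ?frame_lower_gt0 // => x0.
apply: rnorm_eq0; apply/eqP; rewrite -sqrf_eq0; apply/eqP/le_anti.
by rewrite x0 sqr_ge0.
Qed.

(** [D] projects orthogonally onto W and then inverts [S] there, so S D and D S are both that
    projection. Existence is what keeps [moore_penrose] from being the default zero map. *)
Lemma frame_operator_moore_penrose : exists D, is_moore_penrose ip S D.
Proof.
have linS := frame_operator_linear.
have SW := frame_operator_mem.
have [P [linP WP oP _]] := orth_projection ip_norm W_sub.
have /choice[D DP] : forall x, exists y, W y /\ orthc ip W (S y - x).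
  move=> x; apply: (symmetric_coercive_solution ip_norm x W_sub linS _
    frame_lower_gt0 frame_operator_coercive) => y z _ _.
  exact: rip_frame_operator_sym.
have WD x : W (D x) by case: (DP x).
have oD x : orthc ip W (S (D x) - x) by case: (DP x).
have D_eq x y : W y -> orthc ip W (S y - x) -> D x = y.
  move=> Wy yx; apply/eqP; rewrite -subr_eq0; apply/eqP.
  apply: frame_operator_eq0; first exact: subspaceB.
  apply: (orthc_self ip_norm (SW _)).
  rewrite linear_appB // (_ : _ - _ = (S (D x) - x) - (S y - x)); last first.
    by rewrite opprB subrKA.
  exact: orthcB.
have linD : linear D.
  move=> c x y; apply: D_eq; first exact: subspaceP.
  rewrite (linear_appD _ _ linS) (linear_appZ _ _ linS).
  rewrite opprD addrACA -scalerBr.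
  exact: orthc_linear.
have bD x : rnorm (D x) <= a^-1 * rnorm x.
  have [->|D0] := eqVneq (rnorm (D x)) 0.
    by rewrite mulr_ge0 ?rnorm_ge0 // invr_ge0 (ltW frame_lower_gt0).
  have D_gt0 : 0 < rnorm (D x) by rewrite lt0r D0 rnorm_ge0.
  rewrite ler_pdivlMl ?frame_lower_gt0 // -(ler_pM2r D_gt0) -mulrA -expr2.
  apply: le_trans (frame_operator_coercive (WD x)) _.
  apply: le_trans (rip_le ip_norm x _).
  by rewrite -subr_le0 -ripBl (orthc_rip (oD x)).
have SD x : W x -> S (D x) = x.
  move=> Wx; apply/eqP; rewrite -subr_eq0; apply/eqP.
  by apply: (orthc_self ip_norm _ (oD x)); exact: subspaceB.
exists D; split => //.
- apply: (lipschitz_continuous (C := a^-1)) => x y.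
  by rewrite -linear_appB.
- by apply/funext => x; exact: SD (SW x).
- apply/funext => x; apply: (D_eq (S (D x)) _ (WD x)).
  by rewrite subrr; exact: orthc0.
- split; apply: (projection_self_adjoint (E := W)) => x; first exact: SW.
  + by rewrite -opprB -sub0r; apply: orthcB; [exact: orthc0 | exact: oD].
  + exact: WD.
  + have Sx : S (x - D (S x)) = 0 by rewrite linear_appB // SD // subrr.
    (* S z = 0 and S vanishes on W^perp, so S (P z) = 0; injectivity on W gives P z = 0, hence z is
       in W^perp. *)
    set z := x - _ in Sx *.
    have : S (P z) = 0.
      move: Sx; rewrite -{1}(subrK (P z) z) linear_appD //.
      by rewrite frame_operator_orthc // add0r.
    by move=> /(frame_operator_eq0 (WP z)) Pz; rewrite -(subr0 z) -Pz.
Qed.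

Local Notation S' := (moore_penrose ip S).

(** Read off the Penrose equations, whichever map [xget] picks. S' = (S' S) S' with S' S
    self-adjoint and zero on W^perp, so the values of S' are orthogonal to W^perp; and S S' fixes
    the range of S, which contains W by coercivity. *)
Lemma moore_penrose_frame_operator :
  (forall x, W (S' x)) /\ (forall x, W x -> S (S' x) = x).
Proof.
have linS := frame_operator_linear.
have [linS' _ SS'S S'SS' [_ adjS'S]] : is_moore_penrose ip S S'.
  exact: (xgetPex (fun=> 0) frame_operator_moore_penrose).
split=> x.
  apply: (orthc_orthc ip_norm W_sub) => z zW.
  rewrite -[S' in S' x]S'SS' /= -/(S (S' x)).
  have := adjS'S (S' x) z; rewrite /= => ->.
  have -> : synthesis f (analysis ip f z) = 0 by exact: frame_operator_orthc.
  by rewrite (linear_app0 linS') linear0r.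
move=> Wx; have [y [Wy yx]] := symmetric_coercive_solution ip_norm x W_sub linS
  (fun y z _ _ => rip_frame_operator_sym y z)
  frame_lower_gt0 frame_operator_coercive.
have <- : S y = x.
  apply/eqP; rewrite -subr_eq0; apply/eqP; apply: (orthc_self ip_norm _ yx).
  by apply: subspaceB => //; exact: frame_operator_mem.
by have := congr1 (@^~ y) SS'S.
Qed.

End FrameOperator.

(** * The perturbed frame, its dual and the reconstruction error *)

Section Perturbation.
Context {R : realType} {k : scalar_kind}.
Local Notation K := (scalars R k).
Context {H : completeNormedModType K}.
Variable ip : {dot H for @conj R k}.
Hypothesis ip_norm : forall x : H, ip x x = `|x| ^+ 2.
Implicit Types (x y z : H).

Local Notation rip := (real_ip ip).

(** A stand-in for Minkowski's inequality in l^2; optimal weights recover its constant. *)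
Lemma frame_psumD_le (f g h : nat -> H) x N (s t : R) : 0 <= s -> 0 <= t ->
  (forall n, h n = f n + g n) ->
  s * t * frame_psum ip h x N <=
  (s + t) * (s * frame_psum ip f x N + t * frame_psum ip g x N).
Proof.
move=> s0 t0 hE; rewrite /frame_psum mulrDr !mulr_sumr -big_split /=.
apply: ler_sum => n _; rewrite -mulrDr hE ipDr.
exact: rabsD_sqr_le.
Qed.

Variables (W : set H) (f ft : nat -> H) (alpha beta r : R).
Hypotheses (W_sub : closed_subspace W).
Hypothesis f_frame : frame_bounds ip W f alpha beta.
Hypothesis ft_W : forall n, W (ft n).
Hypothesis ft_close : forall x, W x ->
  (frame_sum ip (fun n => f n - ft n)%R x <= (r * rnorm x ^+ 2)%:E)%E.
Hypotheses (r_ge0 : 0 <= r) (r_lt : r < alpha).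

Lemma perturbation_bessel : bessel ip (fun n => f n - ft n) r.
Proof.
apply: (bessel_subspace ip_norm W_sub r_ge0) => [n|x /ft_close/frame_sum_leP //].
by apply: subspaceB => //; case: f_frame.
Qed.

(** The weights are those of the equality case of Young: sqrt r and sqrt alpha - sqrt r for f = ft +
    (f - ft), then sqrt r and sqrt beta for ft = f - (f - ft). *)
Lemma frame_perturbation :
  frame_bounds ip W ft ((Num.sqrt alpha - Num.sqrt r) ^+ 2)
                       ((Num.sqrt r + Num.sqrt beta) ^+ 2).
Proof.
have [fW a0 ab fab] := f_frame.
have b0 : 0 < beta by exact: lt_le_trans ab.
(* For r = 0 the first weight vanishes and the inequality says nothing. But then ft = f: the Bessel
   bound at d = f n - ft n, summed up to n + 1 terms, contains |<d, d>|^2. *)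
have [r0|r0] := eqVneq r 0.
  have -> : ft = f.
    apply/funext => n; apply/eqP; rewrite eq_sym -subr_eq0; apply/eqP.
    apply: rnorm_eq0; set d := f n - ft n.
    have := perturbation_bessel d n.+1.
    rewrite r0 mul0r /frame_psum big_nat_recr //= => psum0.
    have : rabs (ip d d) ^+ 2 <= 0.
      by apply: le_trans psum0; rewrite lerDr sumr_ge0 // => i _; exact: sqr_ge0.
    move=> dd; have /eqP : rabs (ip d d) ^+ 2 = 0.
      by apply/le_anti; rewrite dd sqr_ge0.
    rewrite sqrf_eq0 => /eqP /rabs_eq0 dd0; apply/eqP.
    by rewrite -sqrf_eq0 -(rip_rnorm ip_norm) /real_ip dd0 re0.
  by rewrite r0 sqrtr0 subr0 add0r !sqr_sqrtr ?ltW.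
have r_gt0 : 0 < r by rewrite lt0r r0.
set s := Num.sqrt r; set p := Num.sqrt alpha; set q := Num.sqrt beta.
have s0 : 0 < s by rewrite sqrtr_gt0.
have q0 : 0 < q by rewrite sqrtr_gt0.
have sp : s < p by rewrite ltr_sqrt.
have p0 : 0 < p by exact: lt_trans sp.
have sE : r = s ^+ 2 by rewrite sqr_sqrtr.
have pE : alpha = p ^+ 2 by rewrite sqr_sqrtr // ltW.
have qE : beta = q ^+ 2 by rewrite sqr_sqrtr // ltW.
have ps : 0 < p - s by rewrite subr_gt0.
split=> //.
- by rewrite exprn_gt0.
- have pq : p <= q by rewrite ler_wsqrtr.
  by rewrite ler_sqr ?nnegrE; lra.
move=> x Wx; have [/frame_sum_geP lo /frame_sum_leP up] := fab x Wx.
have close N : frame_psum ip (fun n => f n - ft n) x N <= s ^+ 2 * rnorm x ^+ 2.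
  by rewrite -sE; exact: perturbation_bessel.
split.
  apply/frame_sum_geP => M ftM.
  have fM N : s * (p - s) * frame_psum ip f x N <=
      p * (s * M + (p - s) * (s ^+ 2 * rnorm x ^+ 2)).
    have fE n : f n = ft n + (f n - ft n) by rewrite addrC subrK.
    apply: (le_trans (frame_psumD_le x N (ltW s0) (ltW ps) fE)).
    rewrite [s + _]addrC subrK ler_wpM2l ?(ltW p0) // lerD //.
      by rewrite ler_wpM2l ?(ltW s0).
    by rewrite ler_wpM2l ?(ltW ps).
  have sps : 0 < s * (p - s) by rewrite mulr_gt0.
  have : alpha * rnorm x ^+ 2 <=
      p * (s * M + (p - s) * (s ^+ 2 * rnorm x ^+ 2)) / (s * (p - s)).
    by apply: lo => N; rewrite ler_pdivlMr // mulrC.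
  rewrite ler_pdivlMr // pE => h.
  rewrite -subr_ge0; move: h; rewrite -subr_ge0.
  have -> : p * (s * M + (p - s) * (s ^+ 2 * rnorm x ^+ 2)) -
     p ^+ 2 * rnorm x ^+ 2 * (s * (p - s)) =
     p * s * (M - (p - s) ^+ 2 * rnorm x ^+ 2) by ring.
  by rewrite pmulr_rge0 // mulr_gt0.
apply/frame_sum_leP => N.
have ftE n : ft n = f n + - (f n - ft n) by rewrite opprB addrC subrK.
have := frame_psumD_le x N (ltW s0) (ltW q0) ftE.
have -> : frame_psum ip (fun n => - (f n - ft n)) x N =
    frame_psum ip (fun n => f n - ft n) x N.
  by apply: eq_bigr => n _; rewrite ipNr rabsN.
have sq0 : 0 < s * q by rewrite mulr_gt0.
move=> h; rewrite -(ler_pM2l sq0); apply: (le_trans h).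
apply: (@le_trans _ _ ((s + q) *
    (s * (q ^+ 2 * rnorm x ^+ 2) + q * (s ^+ 2 * rnorm x ^+ 2)))).
  rewrite ler_wpM2l ?addr_ge0 ?(ltW s0) ?(ltW q0) // lerD //.
    by rewrite ler_wpM2l ?(ltW s0) // -qE.
  by rewrite ler_wpM2l ?(ltW q0).
by rewrite le_eqVlt; apply/orP; left; apply/eqP; ring.
Qed.

Variables (V : set H) (eps : R) (g : nat -> H).
Hypotheses (V_sub : closed_subspace V) (WV : direct_sum W (orthc ip V)).
Hypothesis eps_ge0 : 0 <= eps.

Local Notation pi_WV := (oblique_proj W (orthc ip V)).
Local Notation pi_VW := (oblique_proj V (orthc ip W)).
Local Notation S := (synthesis ft \o analysis ip ft).
Local Notation S' := (moore_penrose ip S).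
Local Notation nu := (fine (opnorm pi_VW)).
Local Notation a := ((Num.sqrt alpha - Num.sqrt r) ^+ 2).
Local Notation b := ((Num.sqrt r + Num.sqrt beta) ^+ 2).

Hypothesis r_le : Num.sqrt r * nu <= eps * (Num.sqrt alpha - Num.sqrt r).
Hypothesis gE : forall n, g n = pi_VW (S' (ft n)).

Let ft_frame := frame_perturbation.

Lemma analysis_dual x n : ip x (g n) = ip (S' (pi_WV x)) (ft n).
Proof.
have [_ SS'] := moore_penrose_frame_operator ip_norm W_sub ft_frame.
have [Ww _] := oblique_projP x WV.
(* Writing pi x as S (S' (pi x)) allows the self-adjoint [S] to be moved across, where it cancels S'
   on ft n, a vector of W. *)
rewrite gE -(pi_adjoint ip_norm W_sub V_sub WV) -{1}(SS' _ Ww).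
by rewrite (frame_operator_self_adjoint ip_norm W_sub ft_frame) SS'.
Qed.

Lemma frame_psum_dual x N :
  frame_psum ip g x N = frame_psum ip ft (S' (pi_WV x)) N.
Proof. by apply: eq_bigr => n _; rewrite analysis_dual. Qed.

(** With S y = pi x and D = <S y, y>: D^2 <= |pi x|^2 |y|^2 by Cauchy-Schwarz and a |y|^2 <= D by
    coercivity; then one factor D cancels. *)
Lemma dual_energy_le x :
  a * rip (pi_WV x) (S' (pi_WV x)) <= rnorm (pi_WV x) ^+ 2.
Proof.
have [WS' SS'] := moore_penrose_frame_operator ip_norm W_sub ft_frame.
have [Ww _] := oblique_projP x WV.
have := frame_operator_coercive ip_norm W_sub ft_frame (WS' (pi_WV x)).
rewrite (SS' _ Ww); have := rip_le ip_norm (pi_WV x) (S' (pi_WV x)).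
have := frame_lower_gt0 ft_frame.
have := rnorm_ge0 (pi_WV x); have := rnorm_ge0 (S' (pi_WV x)).
move: (rip _ _) (rnorm _) (rnorm _) (_ ^+ 2) => D n m c n0 m0 c0 Dnm cD.
have D0 : 0 <= D by apply: le_trans cD; rewrite mulr_ge0 ?sqr_ge0 ?ltW.
have [->|D'] := eqVneq D 0; first by rewrite mulr0 sqr_ge0.
have D_gt0 : 0 < D by rewrite lt0r D'.
rewrite -(ler_pM2r D_gt0) -mulrA -expr2.
apply: (@le_trans _ _ (c * (n * m) ^+ 2)).
  by rewrite ler_wpM2l ?(ltW c0) // ler_sqr ?nnegrE ?mulr_ge0.
by rewrite exprMn mulrCA ler_wpM2l ?sqr_ge0.
Qed.

(** The frame sum of g at x is <S y, y> with y = S' (pi x). It lies between a |y|^2, where b |y| >=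
    |pi x| >= |x| on V, and |pi x|^2 / a. *)
Lemma dual_frame : frame ip V g.
Proof.
have [VW _] := direct_sum_adjoint ip_norm W_sub V_sub WV.
have [WS' SS'] := moore_penrose_frame_operator ip_norm W_sub ft_frame.
have a0 := frame_lower_gt0 ft_frame; have b0 := frame_upper_gt0 ft_frame.
have ab0 : 0 < a / b ^+ 2 := divr_gt0 a0 (exprn_gt0 2 b0).
have na0 : 0 <= nu ^+ 2 / a by rewrite divr_ge0 ?sqr_ge0 // ltW.
(* The summand a / b^2 in the upper bound secures lower <= upper, which nu^2 / a alone does not when
   V = 0. *)
exists (a / b ^+ 2), (nu ^+ 2 / a + a / b ^+ 2); split => //.
- by move=> n; rewrite gE; case: (oblique_projP (S' (ft n)) VW).
- by rewrite lerDr.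
move=> x Vx; have [Ww _] := oblique_projP x WV.
have xw := rnorm_le_pi_WV ip_norm WV Vx.
have wx := rnorm_pi_WV ip_norm W_sub V_sub WV x.
split.
  apply/frame_sum_geP => M gM.
  have : rip (S (S' (pi_WV x))) (S' (pi_WV x)) <= M.
    apply: (rip_frame_operator_le ip_norm W_sub ft_frame) => N.
    by rewrite -frame_psum_dual.
  apply: le_trans.
  apply: le_trans (frame_operator_coercive ip_norm W_sub ft_frame (WS' _)).
  have := rnorm_frame_operator_le ip_norm W_sub ft_frame (S' (pi_WV x)).
  rewrite (SS' _ Ww) => wb.
  rewrite -mulrA ler_wpM2l ?(ltW a0) // ler_pdivrMl ?(exprn_gt0 2 b0) // -exprMn.
  rewrite ler_sqr ?nnegrE ?mulr_ge0 ?rnorm_ge0 ?(ltW b0) //.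
  exact: le_trans wb.
apply/frame_sum_leP => N; rewrite frame_psum_dual.
apply: (le_trans (frame_psum_le_rip ip_norm W_sub ft_frame _ N)).
rewrite (SS' _ Ww) mulrDl.
apply: (@le_trans _ _ (nu ^+ 2 / a * rnorm x ^+ 2)); last first.
  by rewrite lerDl mulr_ge0 ?sqr_ge0 ?ltW.
rewrite mulrAC ler_pdivlMr // mulrC.
apply: (le_trans (dual_energy_le x)).
rewrite -exprMn ler_sqr ?nnegrE ?rnorm_ge0 //.
exact: le_trans (rnorm_ge0 _) wx.
Qed.

Lemma dual_error x : rnorm x <= 1 ->
  rnorm (pi_WV x - synthesis f (analysis ip g x)) <= eps.
Proof.
move=> x1; have [Ww _] := oblique_projP x WV.
have [WS' SS'] := moore_penrose_frame_operator ip_norm W_sub ft_frame.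
have a0 := frame_lower_gt0 ft_frame.
have wx := rnorm_pi_WV ip_norm W_sub V_sub WV x.
set y := S' (pi_WV x).
pose c := analysis ip ft y.
have -> : analysis ip g x = c by apply/funext => n; exact: analysis_dual.
have cD N : \sum_(0 <= n < N) rabs (c n) ^+ 2 <= rip (pi_WV x) y.
  rewrite -{1}(SS' _ Ww).
  exact: (frame_psum_le_rip ip_norm W_sub ft_frame y N).
have cvd := synthesis_cvg ip_norm perturbation_bessel r_ge0 cD.
have cvf := synthesis_cvg ip_norm (frame_bessel ip_norm W_sub f_frame)
  (ltW (frame_upper_gt0 f_frame)) cD.
have cvt := @frame_operator_cvg _ _ _ _ ip_norm _ _ _ _ W_sub ft_frame y.
rewrite (SS' _ Ww) in cvt.
have -> : pi_WV x - synthesis f c = - synthesis (fun n => f n - ft n) c.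
  apply: (cvg_unique_seq (cvgB cvt cvf)).
  apply: eq_cvgn (cvgN cvd) => n.
  rewrite !fctE /series /= -sumrB -sumrN; apply: eq_bigr => i _.
  by rewrite -scalerBr -scalerN opprB.
rewrite rnormN -ler_sqr ?nnegrE ?rnorm_ge0 //.
apply: (le_trans (rnorm_synthesis_le ip_norm perturbation_bessel r_ge0 cD)).
rewrite -(ler_pM2l a0) mulrCA.
apply: (@le_trans _ _ (r * rnorm (pi_WV x) ^+ 2)).
  by rewrite ler_wpM2l // dual_energy_le.
(* Both sides are now squares: sqrt r |pi x| is compared with (sqrt alpha - sqrt r) eps, where |pi
   x| <= nu. *)
rewrite -{1}(sqr_sqrtr r_ge0) -!exprMn.
have ps : 0 <= Num.sqrt alpha - Num.sqrt r.
  by rewrite subr_ge0 ler_sqrt ?(ltW r_lt) // (le_trans r_ge0) // ltW.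
rewrite ler_sqr ?nnegrE ?mulr_ge0 ?sqrtr_ge0 ?rnorm_ge0 //.
rewrite [leRHS]mulrC; apply: le_trans r_le; rewrite ler_wpM2l ?sqrtr_ge0 //.
apply: (le_trans wx); rewrite ler_piMr //.
exact: opnorm_pi_VW_ge0.
Qed.

Lemma perturbation_approx_dual : approx_oblique_dual ip W V eps f g.
Proof.
split; [by exists alpha, beta | exact: dual_frame |].
by apply: opnorm_le => x; exact: dual_error.
Qed.

End Perturbation.

Theorem proposition6p2 (R : realType) (k : scalar_kind)
    (H : completeNormedModType (scalars R k))
    (ip : {dot H for @conj R k})
    (ip_norm : forall x : H, ip x x = `|x| ^+ 2)
    (H_sep : separable H)
    (W V : set H)
    (W_sub : closed_subspace W) (V_sub : closed_subspace V)
    (WV : direct_sum W (orthc ip V))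
    (eps alpha beta r : R) (f ft : nat -> H)
    (eps_ge0 : 0 <= eps)
    (f_frame : frame_bounds ip W f alpha beta)
    (ft_W : forall n, W (ft n))
    (ft_close : forall x, W x ->
       (frame_sum ip (fun n => f n - ft n)%R x <= (r * rnorm x ^+ 2)%:E)%E)
    (r_ge0 : 0 <= r)
    (r_le : r <= alpha * eps ^+ 2 /
                 (fine (opnorm (oblique_proj V (orthc ip W))) + eps) ^+ 2) :
  (* for W = 0 the bound on r allows r = alpha, and then the lower bound
     below would not be positive *)
  ((W = [set 0] -> r < alpha) ->
   frame_bounds ip W ft ((Num.sqrt alpha - Num.sqrt r) ^+ 2)
                        ((Num.sqrt r + Num.sqrt beta) ^+ 2)) /\
  (forall g : nat -> H,
     (forall n, g n = oblique_proj V (orthc ip W)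
                        (moore_penrose ip (synthesis ft \o analysis ip ft) (ft n))) ->
     approx_oblique_dual ip W V eps f g).
Proof.
have [_ a0 _ _] := f_frame.
set nu := fine _ in r_le.
have nu0 : 0 <= nu := opnorm_pi_VW_ge0 _ _ _.
have r_lt : W <> [set 0] -> r < alpha.
  move=> W0; have nu1 : 1 <= nu := opnorm_pi_VW_ge1 ip_norm W_sub V_sub WV W0.
  have ne0 : 0 < nu + eps by rewrite ltr_wpDr // (lt_le_trans ltr01).
  apply: (le_lt_trans r_le); rewrite ltr_pdivrMr ?exprn_gt0 //.
  by rewrite ltr_pM2l // ltr_sqr ?nnegrE ?(ltW ne0) // ltrDr (lt_le_trans ltr01).
(* Stated for any [s] because it is applied to [r] and, when W = 0, to 0. *)
have sqrt_le s : 0 <= s -> s <= alpha * eps ^+ 2 / (nu + eps) ^+ 2 ->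
    Num.sqrt s * nu <= eps * (Num.sqrt alpha - Num.sqrt s).
  move=> s0 s_le.
  suff : Num.sqrt s * (nu + eps) <= eps * Num.sqrt alpha by lra.
  have [ne0|ne0] := eqVneq (nu + eps) 0.
    by rewrite ne0 mulr0 mulr_ge0 ?sqrtr_ge0.
  have ne_gt0 : 0 < nu + eps by rewrite lt0r ne0 addr_ge0.
  rewrite -ler_sqr ?nnegrE ?mulr_ge0 ?sqrtr_ge0 ?(ltW ne_gt0) //.
  rewrite !exprMn !sqr_sqrtr ?(ltW a0) // [leRHS]mulrC.
  by rewrite -ler_pdivlMr ?exprn_gt0.
split=> [r_lt0|g gE].
  apply: (frame_perturbation ip_norm W_sub f_frame ft_W ft_close r_ge0).
  by have [/r_lt0|/r_lt] := pselect (W = [set 0]).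
have [W0|W0] := pselect (W = [set 0]).
  (* Here r = alpha may occur. Every x in W is 0, so closeness also holds with r replaced by 0, and
     0 < alpha. *)
  have close0 x : W x ->
      (frame_sum ip (fun n => f n - ft n)%R x <= (0 * rnorm x ^+ 2)%:E)%E.
    move=> Wx; have := ft_close x Wx.
    have -> : x = 0 by move: Wx; rewrite W0.
    by rewrite rnorm0 expr0n !mulr0.
  apply: (perturbation_approx_dual ip_norm W_sub f_frame ft_W close0) => //.
  by apply: sqrt_le => //; rewrite divr_ge0 ?sqr_ge0 // mulr_ge0 ?sqr_ge0 ?(ltW a0).
apply: (perturbation_approx_dual ip_norm W_sub f_frame ft_W ft_close) => //.
  exact: r_lt.
exact: sqrt_le.
Qed.
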